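(* For every $n\in\mathbb{N}$, the group $\theta_n(\mathrm{SL}(2,\mathbb{Z}))$ is conjugate (by a birational map $\mathbb{P}^2\dashrightarrow\mathbb{F}_n$) to a subgroup of $\mathrm{Aut}(\mathbb{F}_n)$, where $\mathbb{F}_n$ is the $n$-th Hirzebruch surface. The groups $\theta_m(\mathrm{SL}(2,\mathbb{Z}))$ and $\theta_n(\mathrm{SL}(2,\mathbb{Z}))$ are conjugate in the Cremona group $\mathrm{Bir}(\mathbb{P}^2)$ if and only if $m=n$.
   Context: All varieties are over $\mathbb{C}$; $\mathbb{N}$ includes $0$; $\mathbf{i}=\sqrt{-1}$. $\mathrm{Bir}(\mathbb{P}^2)$ is the group of birational self-maps of the complex projective plane, identified with $\mathrm{Bir}(\mathbb{C}^2)$. Let $R=\begin{bmatrix}1&1\\0&1\end{bmatrix}$, $S=\begin{bmatrix}0&1\\-1&0\end{bmatrix}$, generators of $\mathrm{SL}(2,\mathbb{Z})$. For $n\in\mathbb{N}$, let $\chi\colon\mathrm{SL}(2,\mathbb{Z})\to\mathbb{C}^*$ be the character (depending on the parity of $n$) with $\chi(RS)=1$ and $\chi(S)=1$ if $n$ is odd, $\chi(S)=\mathbf{i}$ if $n$ is even. In particular $\chi(-\mathrm{Id})\neq(-1)^n$. Define the embedding $\theta_n\colon\mathrm{SL}(2,\mathbb{Z})\to\mathrm{Bir}(\mathbb{P}^2)$ by $$M=\begin{bmatrix}a&b\\c&d\end{bmatrix}\mapsto\left((x,y)\dashrightarrow\left(\frac{ax+b}{cx+d},\ \frac{\chi(M)\,y}{(cx+d)^n}\right)\right).$$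 *)

(* Defs.v *)
From HB Require Import structures.
From mathcomp Require Import all_boot all_order all_algebra generic_quotient.
From mathcomp Require Import boolp classical_sets reals.
From mathcomp Require Import complex mpoly.

Set Implicit Arguments.
Unset Strict Implicit.
Unset Printing Implicit Defensive.

Import Order.TTheory GRing.Theory Num.Theory.

Local Open Scope classical_set_scope.
Local Open Scope quotient_scope.
Local Open Scope complex_scope.
Local Open Scope ring_scope.

(* Complex varieties are treated as spaces with functions: a set of closed   *)
(* points, its Zariski-open subsets, and for every open U the C-valued       *)
(* functions that are regular on U. A regular function is a total function   *)
(* on the points of which only the values on U matter.                       *)
Record variety (R : realType) := Variety {
  point :> Type;
  zopen : set (set point);
  regular : set point -> set (point -> R[i]) }.

Section RationalMaps.
Variable R : realType.
Implicit Types X Y Z : variety R.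

Definition regular_map_on X Y (U : set X) (f : X -> Y) : Prop :=
  forall V : set Y, zopen V ->
    zopen (U `&` f @^-1` V) /\
    (forall g, regular V g -> regular (U `&` f @^-1` V) (g \o f)).

(* The values of pfun outside pdom are irrelevant. *)
Record pmap X Y := PMap { pdom : set X; pfun :> X -> Y }.

Definition pcomp X Y Z (g : pmap Y Z) (f : pmap X Y) : pmap X Z :=
  PMap (pdom f `&` f @^-1` pdom g) (g \o f).

Definition ptotal X Y (f : X -> Y) : pmap X Y := PMap setT f.

Definition pid X : pmap X X := ptotal id.

(* All the varieties below are irreducible, so that nonempty open subsets    *)
(* are dense.                                                                *)
Definition is_rational X Y (f : pmap X Y) : Prop :=
  [/\ zopen (pdom f), pdom f !=set0 & regular_map_on (pdom f) f].

(* Equality of rational maps. *)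
Definition rat_eq X Y (f g : pmap X Y) : Prop :=
  exists U : set X, [/\ zopen U, U !=set0, U `<=` pdom f `&` pdom g
                      & forall x, U x -> f x = g x].

Definition birational_inverses X Y (f : pmap X Y) (g : pmap Y X) : Prop :=
  [/\ is_rational f, is_rational g,
      rat_eq (pcomp g f) (pid X) & rat_eq (pcomp f g) (pid Y)].

Definition is_automorphism X (f : X -> X) : Prop :=
  regular_map_on setT f /\
  exists g : X -> X, [/\ cancel f g, cancel g f & regular_map_on setT g].

Definition Aut_subgroup X (H : set (X -> X)) : Prop :=
  [/\ forall f, H f -> is_automorphism f,
      H id,
      forall f g, H f -> H g -> H (f \o g)
    & forall f g, H f -> cancel f g -> cancel g f -> H g].

(* f G f^-1 = H as sets of rational maps, where f^-1 = g. *)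
Definition conjugates X Y (f : pmap X Y) (g : pmap Y X)
    (G : set (pmap X X)) (H : set (pmap Y Y)) : Prop :=
  (forall a, G a -> exists2 b, H b & rat_eq (pcomp f (pcomp a g)) b) /\
  (forall b, H b -> exists2 a, G a & rat_eq (pcomp f (pcomp a g)) b).

Definition birationally_conjugate X Y (G : set (pmap X X))
    (H : set (pmap Y Y)) : Prop :=
  exists (f : pmap X Y) (g : pmap Y X),
    birational_inverses f g /\ conjugates f g G H.

End RationalMaps.

Section Quotients.
Variables (R : realType) (N : nat).
Local Notation C := (R[i]).

Definition peval (p : {mpoly C[N]}) (v : 'rV[C]_N) : C := p.@[fun j => v 0 j].

Definition vzopen : set (set 'rV[C]_N) :=
  [set U | exists S : set {mpoly C[N]},
     U = [set v | exists2 p, S p & peval p v != 0]].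

Definition vregular (U : set 'rV[C]_N) : set ('rV[C]_N -> C) :=
  [set f | forall v, U v -> exists V p q,
     [/\ vzopen V, V v, V `<=` U
       & forall w, V w -> peval q w != 0 /\ f w = peval p w / peval q w]].

(* The quotient of an open subset A of C^N by a (group action) equivalence   *)
(* relation e, with the quotient topology and the structure sheaf of         *)
(* invariant functions.                                                      *)
Variables (A : pred 'rV[C]_N) (e : equiv_rel {v : 'rV[C]_N | A v}).

Definition preim_pi (U : set {eq_quot e}) : set 'rV[C]_N :=
  [set val a | a in [set a | U (\pi a)]].

Definition quotient_variety : variety R :=
  @Variety R {eq_quot e}
    [set U | vzopen (preim_pi U)]
    (fun U => [set g | exists2 f, vregular (preim_pi U) f
                     & forall a, U (\pi a) -> f (val a) = g (\pi a)]).

End Quotients.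

Section Surfaces.
Variable R : realType.
Local Notation C := (R[i]).

(** The projective plane: C^3 \ 0 modulo scaling. *)

Definition P2_cone : pred 'rV[C]_3 := [pred v : 'rV[C]_3 | v != 0].

Definition P2_rel : rel {v | P2_cone v} :=
  [rel a b | `[< exists2 l : C, l != 0 & val b = l *: val a >]].

Lemma P2_rel_equiv : equiv_class_of P2_rel.
Proof.
split.
- by move=> a; apply/asboolP; exists 1; rewrite ?oner_neq0 ?scale1r.
- suff H a b : P2_rel a b -> P2_rel b a by move=> a b; apply/idP/idP; exact: H.
  move=> /asboolP[l l0 E]; apply/asboolP; exists l^-1; first by rewrite invr_eq0.
  by rewrite E scalerA mulVf // scale1r.
- move=> b a c /asboolP[l l0 E] /asboolP[m m0 E']; apply/asboolP.
  by exists (m * l); rewrite ?mulf_neq0 // E' E scalerA.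
Qed.

Definition P2_equiv : equiv_rel {v | P2_cone v} := EquivRelPack P2_rel_equiv.

Definition P2 : variety R := quotient_variety P2_equiv.

(** The Hirzebruch surface F_n: the quotient of (C^2 \ 0) x (C^2 \ 0), with
    coordinates (y_0, y_1; z_0, z_1), by the action of (C^* )^2
    (mu, rho).(y_0, y_1; z_0, z_1)
      = (mu rho^-n y_0, mu y_1; rho z_0, rho z_1).
    The ruling over P^1 is [z_0 : z_1]. *)

Definition Hirz_cone : pred 'rV[C]_4 :=
  [pred v : 'rV[C]_4 | ((v 0 0 != 0) || (v 0 1 != 0)) &&
            ((v 0 2%:R != 0) || (v 0 3%:R != 0))].

Definition Hirz_act (n : nat) (mu rho : C) (v : 'rV[C]_4) : 'rV[C]_4 :=
  \row_j ([:: mu * rho ^- n; mu; rho; rho]`_j * v 0 j).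

Definition Hirz_rel (n : nat) : rel {v | Hirz_cone v} :=
  [rel a b | `[< exists mu rho : C,
     [/\ mu != 0, rho != 0 & val b = Hirz_act n mu rho (val a)] >]].

Lemma Hirz_act1 n v : Hirz_act n 1 1 v = v.
Proof.
apply/rowP=> j; rewrite mxE expr1n invr1 mulr1.
by case: j => [[|[|[|[|j]]]]] //= jP; rewrite mul1r.
Qed.

Lemma Hirz_actM n m1 r1 m2 r2 v :
  Hirz_act n m1 r1 (Hirz_act n m2 r2 v) = Hirz_act n (m1 * m2) (r1 * r2) v.
Proof.
apply/rowP=> j; rewrite !mxE mulrA; congr (_ * _).
case: j => [[|[|[|[|j]]]]] //= _.
by rewrite exprMn invfM mulrACA.
Qed.

Lemma Hirz_rel_equiv n : equiv_class_of (Hirz_rel n).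
Proof.
split.
- by move=> a; apply/asboolP; exists 1, 1; rewrite oner_neq0 Hirz_act1.
- suff H a b : Hirz_rel n a b -> Hirz_rel n b a.
    by move=> a b; apply/idP/idP; exact: H.
  move=> /asboolP[m [r [m0 r0 E]]]; apply/asboolP; exists m^-1, r^-1.
  by rewrite !invr_eq0 E Hirz_actM !mulVf // Hirz_act1.
- move=> b a c /asboolP[m [r [m0 r0 E]]] /asboolP[m' [r' [m0' r0' E']]].
  apply/asboolP; exists (m' * m), (r' * r).
  by rewrite !mulf_neq0 // E' E Hirz_actM.
Qed.

Definition Hirzebruch (n : nat) : variety R :=
  quotient_variety (EquivRelPack (Hirz_rel_equiv n)).

(** C^2 as the open subset [x : y : 1] of the projective plane. *)

Definition hvec (x y : C) : 'rV[C]_3 := \row_j [:: x; y; 1]`_j.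

Lemma hvec_cone x y : P2_cone (hvec x y).
Proof.
apply/eqP => /rowP /(_ 2%:R) /eqP; rewrite !mxE /=.
exact/negP/oner_neq0.
Qed.

Definition affine_pt (x y : C) : P2 :=
  \pi_{eq_quot P2_equiv} (exist (fun v => P2_cone v) (hvec x y) (hvec_cone x y)).

Definition hrepr (p : P2) : 'rV[C]_3 := val (repr (p : {eq_quot P2_equiv})).

Definition xcoord (p : P2) : C := hrepr p 0 0 / hrepr p 0 2%:R.
Definition ycoord (p : P2) : C := hrepr p 0 1 / hrepr p 0 2%:R.

Lemma affine_ptK x y :
  (xcoord (affine_pt x y) = x) * (ycoord (affine_pt x y) = y).
Proof.
rewrite /xcoord /ycoord /hrepr.
have /eqmodP/asboolP[l l0 E] :
    \pi_{eq_quot P2_equiv} (exist (fun v => P2_cone v) _ (hvec_cone x y)) =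
    \pi_{eq_quot P2_equiv} (repr (affine_pt x y : {eq_quot P2_equiv})).
  by rewrite reprK.
by rewrite E !mxE /= mulr1 ![l * _]mulrC !mulfK.
Qed.

End Surfaces.

Section Embeddings.
Variable R : realType.
Local Notation C := (R[i]).

Definition mx2 (a b c d : int) : 'M[int]_2 :=
  \matrix_(i, j) if i == 0 then if j == 0 then a else b
                 else if j == 0 then c else d.

Definition mxR : 'M[int]_2 := mx2 1 1 0 1.
Definition mxS : 'M[int]_2 := mx2 0 1 (-1) 0.

Definition SL2Z : set 'M[int]_2 := [set M | \det M = 1].

(* Only the values of chi on SL(2,Z) matter. *)
Definition theta_character (n : nat) (chi : 'M[int]_2 -> C) : Prop :=
  [/\ forall M, SL2Z M -> chi M != 0,
      forall M N, SL2Z M -> SL2Z N -> chi (M *m N) = chi M * chi N,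
      chi (mxR *m mxS) = 1
    & chi mxS = if odd n then 1 else 'i%C].

(* The characters exist (and are unique, as R S and S generate SL(2,Z)): for  *)
(* n even, chi M = i ^+ log_chi M factors through SL(2,Z/4). The formula is  *)
(* the reduction mod 4 of the abelianisation SL(2,Z) -> Z/12, up to sign.    *)
Definition log_chi (a b c d : 'Z_4) : 'Z_4 :=
  (c ^+ 2 - 1) * (b * d + 3%:R * (c - 1) * d + c + 3%:R) - c * (a + d - 3%:R).

Lemma log_chiM (a b c d a' b' c' d' : 'Z_4) :
  a * d - b * c = 1 -> a' * d' - b' * c' = 1 ->
  log_chi (a * a' + b * c') (a * b' + b * d') (c * a' + d * c') (c * b' + d * d')
  = log_chi a b c d + log_chi a' b' c' d'.
Proof.
pose Z4 : seq 'Z_4 := [:: 0; 1; 2%:R; 3%:R].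
have inZ4 (x : 'Z_4) : x \in Z4 by case: x => [[|[|[|[|x]]]]].
pose G := [seq m <- [seq (u, v) | u <- [seq (x, y) | x <- Z4, y <- Z4],
                                  v <- [seq (x, y) | x <- Z4, y <- Z4]]
          | m.1.1 * m.2.2 - m.1.2 * m.2.1 == 1].
have inG x y z t : x * t - y * z = 1 -> ((x, y), (z, t)) \in G.
  move=> h; rewrite mem_filter h eqxx andTb.
  have in2 u v : (u, v) \in [seq (x, y) | x <- Z4, y <- Z4].
    by apply/allpairsP; exists (u, v); rewrite !inZ4.
  by apply/allpairsP; exists ((x, y), (z, t)); rewrite !in2.
have : all (fun m => all (fun m' =>
  log_chi (m.1.1 * m'.1.1 + m.1.2 * m'.2.1) (m.1.1 * m'.1.2 + m.1.2 * m'.2.2)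
          (m.2.1 * m'.1.1 + m.2.2 * m'.2.1) (m.2.1 * m'.1.2 + m.2.2 * m'.2.2)
  == log_chi m.1.1 m.1.2 m.2.1 m.2.2 + log_chi m'.1.1 m'.1.2 m'.2.1 m'.2.2) G) G.
  by vm_compute.
move=> /allP h /inG i /inG i'.
by have /allP /(_ _ i') /eqP := h _ i.
Qed.

Lemma theta_character_exists (n : nat) :
  exists chi : 'M[int]_2 -> C, theta_character n chi.
Proof.
case: (boolP (odd n)) => on.
  by exists (fun=> 1); split; rewrite ?on ?mulr1 // => M _; exact: oner_neq0.
have i4 : 'i%C ^+ 4 = 1 :> R[i] by rewrite (exprM _ 2 2) sqr_i sqrrN expr1n.
have i0 : 'i%C != 0 :> R[i].
  by apply/eqP => h; move: i4; rewrite h expr0n /= => /esym/eqP; rewrite oner_eq0.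
pose l (M : 'M[int]_2) := log_chi (M 0 0)%:~R (M 0 1)%:~R (M 1 0)%:~R (M 1 1)%:~R.
have det (M : 'M[int]_2) : SL2Z M ->
    (M 0 0)%:~R * (M 1 1)%:~R - (M 0 1)%:~R * (M 1 0)%:~R = 1 :> 'Z_4.
  rewrite /SL2Z /= (expand_det_row _ 0) !big_ord_recl big_ord0.
  rewrite /cofactor !det_mx11 !mxE /= expr0 expr1 mul1r mulN1r mulrN addr0.
  have -> : lift 0 0 = 1 :> 'I_2 by apply: val_inj.
  have -> : lift 1 0 = 0 :> 'I_2 by apply: val_inj.
  by rewrite -!intrM -intrB => ->.
exists (fun M => 'i%C ^+ (l M)); split.
- by move=> M _; exact: expf_neq0.
- move=> M N /det dM /det dN.
  rewrite -exprD -[RHS](expr_mod _ i4); congr (_ ^+ _).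
  rewrite -[RHS]/(val (l M + l N)) /l -log_chiM //.
  rewrite !mxE !big_ord_recl !big_ord0 !addr0 !intrD !intrM.
  by have -> : lift ord0 ord0 = 1 :> 'I_2 by apply: val_inj.
- have -> : l (mxR *m mxS) = 0; last by rewrite expr0.
  by rewrite /l !mxE !big_ord_recl !big_ord0 !mxE; apply/eqP; vm_compute.
- have -> : l mxS = 1; last by rewrite expr1 (negbTE on).
  by rewrite /l !mxE; apply/eqP; vm_compute.
Qed.

Definition theta (n : nat) (chi : 'M[int]_2 -> C) (M : 'M[int]_2) :
    pmap (P2 R) (P2 R) :=
  let a : C := (M 0 0)%:~R in let b : C := (M 0 1)%:~R in
  let c : C := (M 1 0)%:~R in let d : C := (M 1 1)%:~R in
  PMap
    [set p | exists x y : C, p = affine_pt x y /\ c * x + d != 0]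
    (fun p => let x := xcoord p in let y := ycoord p in
       affine_pt ((a * x + b) / (c * x + d)) (chi M * y / (c * x + d) ^+ n)).

Definition theta_SL2Z (n : nat) (chi : 'M[int]_2 -> C) :
    set (pmap (P2 R) (P2 R)) :=
  [set theta n chi M | M in SL2Z].

End Embeddings.

(* Main.v *)
Require Import Defs.
From mathcomp Require Import all_boot all_order all_algebra generic_quotient.
From mathcomp Require Import polyXY ring.
From mathcomp Require Import boolp classical_sets reals complex mpoly.
Import Defs.

(** The linear map (y_0, y_1; z_0, z_1) |-> (y_0, chi(M) y_1; a z_0 + b z_1,
    c z_0 + d z_1) commutes with the torus action that defines F_n, so it induces
    an automorphism of F_n; in the coordinates x = z_0 / z_1 and
    y = y_1 / (y_0 z_1^n) it is theta_n(M). This gives the first assertion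
    ([theta_conjugate_hirz]).

    For the second one, let f = (P, Q) be birational and conjugate theta_m(SL(2,Z))
    to theta_n(SL(2,Z)): for every M there is M' with P o theta_m(M) = M' . P and
    Q o theta_m(M) = chi_n(M') Q / (c' P + d')^n. It is enough to show that m
    divides n ([weight_divides]), since the inverse of f then shows that n
    divides m.

    Step 1: P depends on x only ([P_mobius]). The matrix T = [1, 4; 0, 1] acts by
    (x, y) |-> (x + 4, y), because chi_m(T) = 1. A rational function that is
    multiplied by a constant under x |-> x + 4 is a function of y
    ([translation_scaling]). Moving a fixed point of the image A of T to infinity,
    this forces A to be parabolic and P to be, up to a constant Moebius
    transformation, t x + h(y) with t nonzero ([P_linearization]). The matrix - Id
    acts by (x, y) |-> (x, - y) and its image acts trivially on P, so h is even
    ([P_even]).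
    Finally S gives - t / x + h(Y) = B . (t x + h(y)) for some matrix B, where
    Y = s y / (- x)^m. The substitution (x, y) |-> (- x, (- 1)^m y) preserves Y and
    h(y); the difference of the two equations reads
    (B_3 h(y) + B_4)^2 - B_3^2 t^2 x^2 = - (det B) x^2,
    whose constant term in x gives B_3 h(y) + B_4 = 0. As B_3 = 0 would give
    det B = 0, h is constant.

    Step 2: comparing weights. As P is a Moebius function (e_1 x + f_1) /
    (e_2 x + f_2) of x, the function beta = Q (e_2 x + f_2)^n satisfies
    beta o theta_m(M) = const beta / (c x + d)^n ([semi_invariant]). Applied to T,
    this shows that beta is a function of y; applied to S, that
    beta(c_1 u^m) = c_2 u^n. Comparing degrees, m divides n.

    Everything is done with functions on C^2 that are defined and rational off the
    zeros of a nonzero polynomial. This is how a rational self-map of the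
    projective plane looks in the affine chart, by density of that chart
    ([zopen_generic], [regular_ratfun]); dominance of the map makes substitution
    into generic statements legitimate ([dominant_generic]). *)

Set Implicit Arguments.
Unset Strict Implicit.
Unset Printing Implicit Defensive.

Import Order.TTheory GRing.Theory Num.Theory.

Local Open Scope classical_set_scope.
Local Open Scope quotient_scope.
Local Open Scope complex_scope.
Local Open Scope ring_scope.

(** * Generic statements on the affine plane *)

Section Generic.
Variable F : numClosedFieldType.
Implicit Types (p q : {poly F}) (u v w d : {poly {poly F}}).

Definition cofinitely (A : F -> Prop) : Prop :=
  exists s : seq F, forall x, x \notin s -> A x.

(** The nonempty Zariski-open subsets of the plane form a filter; a principal
    open set in each member is all that is needed. *)
Definition generically (A : F -> F -> Prop) : Prop :=
  exists2 d : {poly {poly F}}, d != 0 & forall x y, d.[x, y] != 0 -> A x y.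

Lemma cofinitelyW (A B : F -> Prop) :
  (forall x, A x -> B x) -> cofinitely A -> cofinitely B.
Proof. by move=> AB [s sA]; exists s => x /sA/AB. Qed.

Lemma cofinitely_and (A B : F -> Prop) :
  cofinitely A -> cofinitely B -> cofinitely (fun x => A x /\ B x).
Proof.
move=> [s sA] [t tB]; exists (s ++ t) => x.
by rewrite mem_cat negb_or => /andP[/sA ? /tB].
Qed.

Lemma cofinitely_neq (a : F) : cofinitely (fun x => x != a).
Proof. by exists [:: a] => x; rewrite inE. Qed.

Lemma cofinitely_poly p : p != 0 -> cofinitely (fun x => p.[x] != 0).
Proof.
move=> p0; have [s ps] := closed_field_poly_normal p.
exists s => x; apply: contraNneq => px; rewrite -(root_prod_XsubC s).
by move/rootP: px; rewrite ps rootZ ?lead_coef_eq0.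
Qed.

Lemma cofinitely_inj (h : F -> F) (k : F -> F) (A : F -> Prop) :
  cancel h k -> cofinitely A -> cofinitely (fun x => A (h x)).
Proof.
move=> hK [s sA]; exists (map k s) => x xs; apply: sA.
by apply: contra xs => hs; rewrite -(hK x) map_f.
Qed.

(** Turns a cofinite condition into an infinite supply of explicit points that
    are stable under x |-> x + 4. *)
Lemma cofinitely_nat (A : F -> Prop) :
  cofinitely A -> exists K : nat, forall k, (K <= k)%N -> A k%:R.
Proof.
move=> [s]; elim: s A => [|r s IH] A sA; first by exists 0%N => k _; exact: sA.
have [|K KA] := IH (fun x => x != r -> A x).
  by move=> x xs xr; apply: sA; rewrite inE negb_or xr.
have [[k0 k0r]|nr] := pselect (exists k0 : nat, k0%:R = r).
  exists (maxn K k0.+1) => k; rewrite geq_max => /andP[Kk k0k].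
  by apply: KA => //; rewrite -k0r eqr_nat neq_ltn k0k orbT.
exists K => k Kk; apply: KA => //.
by apply/eqP => kr; apply: nr; exists k.
Qed.

Lemma cofinitely_ex (A : F -> Prop) : cofinitely A -> exists x, A x.
Proof. by move/cofinitely_nat => [K /(_ K (leqnn K))]; exists K%:R. Qed.

Lemma poly_eq0_nat p (K : nat) :
  (forall k, (K <= k)%N -> p.[k%:R] = 0) -> p = 0.
Proof.
move=> pK; apply/eqP/negPn/negP => /cofinitely_poly /cofinitely_nat[L pL].
have := pL _ (leq_maxr K L); rewrite pK ?eqxx //; exact: leq_maxl.
Qed.

Lemma poly_eq0_cof p : cofinitely (fun x => p.[x] = 0) -> p = 0.
Proof. by move/cofinitely_nat => [K]; exact: poly_eq0_nat. Qed.

Lemma poly_eq_cof p q : cofinitely (fun x => p.[x] = q.[x]) -> p = q.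
Proof.
move=> pq; apply/eqP; rewrite -subr_eq0; apply/eqP/poly_eq0_cof.
by apply: cofinitelyW pq => x; rewrite hornerD hornerN => ->; rewrite subrr.
Qed.

(** Read d as a polynomial in y with coefficients in x: where the leading one is
    nonzero, d restricts to a nonzero polynomial on the vertical line. *)
Lemma generic_fiberX (A : F -> F -> Prop) :
  generically A -> cofinitely (fun x => cofinitely (A x)).
Proof.
move=> [d d0 dA].
have /cofinitely_poly : lead_coef (swapXY d) != 0.
  by rewrite lead_coef_eq0 swapXY_eq0.
apply: cofinitelyW => x Lx.
have /cofinitely_poly : d.[x%:P] != 0.
  apply: contraNneq Lx => dx; rewrite -[_.[x]]/(horner_eval x _).
  by rewrite lead_coefE -coef_map /= -horner_polyC dx coef0.
by apply: cofinitelyW => y; exact: dA.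
Qed.

Lemma generic_swap (A : F -> F -> Prop) :
  generically A -> generically (fun x y => A y x).
Proof.
move=> [d d0 dA]; exists (swapXY d); first by rewrite swapXY_eq0.
by move=> x y; rewrite horner2_swapXY; exact: dA.
Qed.

Lemma generic_fiberY (A : F -> F -> Prop) :
  generically A -> cofinitely (fun y => cofinitely (A^~ y)).
Proof. by move/generic_swap/generic_fiberX. Qed.

Lemma generic_ex (A : F -> F -> Prop) :
  generically A -> exists x y, A x y.
Proof.
by move/generic_fiberX/cofinitely_ex => [x /cofinitely_ex[y ?]]; exists x, y.
Qed.

Lemma genericW (A B : F -> F -> Prop) :
  (forall x y, A x y -> B x y) -> generically A -> generically B.
Proof. by move=> AB [d d0 dA]; exists d => // x y /dA/AB. Qed.

Lemma generic_and (A B : F -> F -> Prop) :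
  generically A -> generically B -> generically (fun x y => A x y /\ B x y).
Proof.
move=> [d d0 dA] [e e0 eB]; exists (d * e); first by rewrite mulf_neq0.
by move=> x y; rewrite !hornerM mulf_eq0 negb_or => /andP[/dA ? /eB].
Qed.

Lemma generic_poly u : u != 0 -> generically (fun x y => u.[x, y] != 0).
Proof. by exists u. Qed.

Lemma generic_cofX (A : F -> Prop) :
  cofinitely A -> generically (fun x _ => A x).
Proof.
move=> [s sA]; exists (\prod_(r <- s) ('X - r%:P%:P)).
  by rewrite monic_neq0 // monic_prod_XsubC.
move=> x y; rewrite !horner_prod => sx; apply: sA; apply: contra sx => xs.
by rewrite prodf_seq_eq0; apply/hasP; exists x; rewrite //= !hornerE subrr.
Qed.

Lemma generic_cofY (A : F -> Prop) :
  cofinitely A -> generically (fun _ y => A y).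
Proof. by move/generic_cofX/generic_swap. Qed.

End Generic.

(** * Rational functions and substitution *)

Section FunctionAlgebras.
Variables (F : numClosedFieldType) (T : Type) (alg : (T -> F) -> Prop).

Definition function_algebra : Prop :=
  [/\ forall c, alg (fun=> c),
      forall f g, alg f -> alg g -> alg (fun t => f t + g t)
    & forall f g, alg f -> alg g -> alg (fun t => f t * g t)].

Hypothesis algP : function_algebra.

(** Serves both for polynomials on the plane, where w is the denominator of a
    rational map, and for forms on C^3, where w is the coordinate at infinity. *)
Lemma clear_denominators (u v w : T -> F) :
  alg u -> alg v -> alg w -> forall e : {poly {poly F}},
  exists E N, alg E /\
    forall t, w t != 0 -> E t = w t ^+ N * e.[u t / w t, v t / w t].
Proof.
have [alg_cst alg_add alg_mul] := algP; move=> au av aw.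
pose clr f := exists E N, alg E /\ forall t, w t != 0 -> E t = w t ^+ N * f t.
have alg_exp N : alg (fun t => w t ^+ N).
  elim: N => [|N IH]; first by under eq_fun do rewrite expr0; exact: alg_cst.
  by under eq_fun do rewrite exprS; exact: alg_mul.
have clr_cst c : clr (fun=> c).
  by exists (fun=> c), 0%N; split=> // t _; rewrite mul1r.
have clr_add f g : clr f -> clr g -> clr (fun t => f t + g t).
  move=> [E [N [aE hE]]] [E' [N' [aE' hE']]].
  exists (fun t => w t ^+ N' * E t + w t ^+ N * E' t), (N + N')%N; split.
    by apply: alg_add; apply: alg_mul.
  by move=> t wt; rewrite hE // hE' // exprD; ring.
have clr_mul f g : clr f -> clr g -> clr (fun t => f t * g t).
  move=> [E [N [aE hE]]] [E' [N' [aE' hE']]].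
  exists (fun t => E t * E' t), (N + N')%N; split; first exact: alg_mul.
  by move=> t wt; rewrite hE // hE' // exprD; ring.
have clr_div f : alg f -> clr (fun t => f t / w t).
  by move=> af; exists f, 1%N; split=> // t wt; rewrite expr1 mulrC divfK.
have clr_ext f g : f =1 g -> clr f -> clr g by move=> /funext ->.
elim/poly_ind => [|e p IHe].
  by apply: clr_ext (clr_cst 0) => t; rewrite !horner0.
have clr_p : clr (fun t => p.[v t / w t]).
  elim/poly_ind: p => [|p c IHp].
    by apply: clr_ext (clr_cst 0) => t; rewrite horner0.
  apply: clr_ext (clr_add _ _ (clr_mul _ _ IHp (clr_div _ av)) (clr_cst c)) => t.
  by rewrite hornerMXaddC.
apply: clr_ext (clr_add _ _ (clr_mul _ _ IHe (clr_div _ au)) clr_p) => t.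
by rewrite hornerMXaddC hornerD hornerM hornerC.
Qed.

End FunctionAlgebras.

Section RationalFunctions.
Variable F : numClosedFieldType.
Implicit Types (p q : {poly F}) (u v w d : {poly {poly F}}) (f g : F -> F -> F).

Lemma polyXY_clear_denominators u v w (e : {poly {poly F}}) :
  exists E : {poly {poly F}}, exists N : nat, forall x y, w.[x, y] != 0 ->
  E.[x, y] = w.[x, y] ^+ N * e.[u.[x, y] / w.[x, y], v.[x, y] / w.[x, y]].
Proof.
pose alg (f : F * F -> F) :=
  exists u : {poly {poly F}}, forall t, f t = u.[t.1, t.2].
have algE (u' : {poly {poly F}}) : alg (fun t => u'.[t.1, t.2]) by exists u'.
have [|E [N [[E' EE'] hE]]] := @clear_denominators F _ alg _ _ _ _
  (algE u) (algE v) (algE w) e; last first.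
  by exists E', N => x y wxy; rewrite -(EE' (x, y)) hE.
split.
- by move=> c; exists c%:P%:P => t; rewrite !hornerC.
- by move=> f g [u1 h1] [u2 h2]; exists (u1 + u2) => t; rewrite !hornerD h1 h2.
- by move=> f g [u1 h1] [u2 h2]; exists (u1 * u2) => t; rewrite !hornerM h1 h2.
Qed.

(** After clearing denominators the pullback of a nonzero polynomial is again a
    polynomial, and it is nonzero because the map is generically onto. *)
Lemma generic_pull u v w (A : F -> F -> Prop) :
  generically (fun x' y' => exists x y,
    [/\ w.[x, y] != 0, u.[x, y] / w.[x, y] = x' & v.[x, y] / w.[x, y] = y']) ->
  generically A ->
  generically (fun x y => A (u.[x, y] / w.[x, y]) (v.[x, y] / w.[x, y])).
Proof.
move=> onto [e e0 eA].
have [E [N hE]] := polyXY_clear_denominators u v w e.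
have /generic_ex[_ [_ [[x [y [wxy <- <-]]] exy]]] :=
  generic_and onto (generic_poly e0).
have wE0 : w * E != 0.
  apply/eqP => wE; have /eqP := mulf_neq0 wxy (mulf_neq0 (expf_neq0 N wxy) exy).
  by rewrite -hE // -!hornerM wE !horner0.
exists (w * E) => // x1 y1; rewrite !hornerM mulf_eq0 negb_or => /andP[w1 E1].
apply: eA; apply: contraNneq E1 => e1; by rewrite hE // e1 mulr0.
Qed.

Definition mobius (a b c d x : F) : F := (a * x + b) / (c * x + d).

(** The transformations are invertible where both denominators are nonzero, so
    they are generically onto. The maps (x, y) |-> (al x + be, ep y) are the case
    c = 0, n = 0. *)
Lemma generic_mobius_pull (a b c d k : F) (n : nat) (A : F -> F -> Prop) :
  a * d - b * c != 0 -> k != 0 -> generically A ->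
  generically (fun x y => A (mobius a b c d x) (k * y / (c * x + d) ^+ n)).
Proof.
move=> det0 k0 gA.
pose j : {poly {poly F}} := c%:P%:P * 'X + d%:P%:P.
have jE x y : j.[x, y] = c * x + d by rewrite !hornerE.
pose u : {poly {poly F}} := (a%:P%:P * 'X + b%:P%:P) * j ^+ n.
pose v : {poly {poly F}} := k%:P%:P * 'X%:P * j.
pose w : {poly {poly F}} := j ^+ n.+1.
have j0 : j != 0.
  apply: contraNneq det0 => j0.
  have d0 : d = 0 by have := jE 0 0; rewrite j0 !horner0 mulr0 add0r.
  have c0 : c = 0 by have := jE 1 0; rewrite j0 !horner0 mulr1 d0 addr0.
  by rewrite d0 c0 !mulr0 subrr.
have uE x y : u.[x, y] = (a * x + b) * (c * x + d) ^+ n.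
  by rewrite !hornerM !horner_exp jE !hornerE.
have vE x y : v.[x, y] = k * y * (c * x + d).
  by rewrite !hornerM jE !hornerE.
have wE x y : w.[x, y] = (c * x + d) ^+ n.+1 by rewrite !horner_exp jE.
have eqs x y : c * x + d != 0 ->
    u.[x, y] / w.[x, y] = mobius a b c d x /\
    v.[x, y] / w.[x, y] = k * y / (c * x + d) ^+ n.
  move=> jx; have jn := expf_neq0 n jx.
  by rewrite uE vE wE /mobius exprS; split; field; rewrite ?jx ?jn.
have onto : generically (fun x' y' => exists x y,
    [/\ w.[x, y] != 0, u.[x, y] / w.[x, y] = x' & v.[x, y] / w.[x, y] = y']).
  have i0 : (- c)%:P * 'X + a%:P != 0 :> {poly F}.
    apply: contraNneq det0 => i0.
    have iE x : - c * x + a = 0.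
      by have := horner0 x; rewrite -i0 !hornerE.
    have a0 : a = 0 by have := iE 0; rewrite mulr0 add0r.
    have /eqP := iE 1; rewrite a0 mulr1 addr0 oppr_eq0 => /eqP ->.
    by rewrite mul0r mulr0 subrr.
  have := generic_cofX (cofinitely_poly i0); apply: genericW => x' y'.
  rewrite !hornerE mulNr addrC => jx'.
  pose x := (d * x' - b) / (a - c * x').
  have jx : c * x + d = (a * d - b * c) / (a - c * x') by rewrite /x; field.
  have jx0 : c * x + d != 0 by rewrite jx mulf_neq0 // invr_neq0.
  have jxn := expf_neq0 n jx0.
  exists x, (y' * (c * x + d) ^+ n / k).
  have [-> ->] := eqs x (y' * (c * x + d) ^+ n / k) jx0.
  rewrite wE expf_neq0 //; split=> //; last by field; rewrite k0 jxn.
  by rewrite /mobius jx /x; field; rewrite det0 jx'.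
have := generic_and (generic_poly j0) (generic_pull onto gA).
by apply: genericW => x y; rewrite jE => -[/(eqs _ y)[-> ->]].
Qed.

Definition ratfun f : Prop := exists u v,
  v != 0 /\ generically (fun x y => f x y = u.[x, y] / v.[x, y]).

Lemma ratfun_poly u : ratfun (fun x y => u.[x, y]).
Proof.
exists u, 1; rewrite oner_neq0; split=> //.
by exists 1 => [|x y _]; rewrite ?oner_neq0 // !hornerC divr1.
Qed.

Lemma ratfun_cst (c : F) : ratfun (fun _ _ => c).
Proof. by have := ratfun_poly c%:P%:P; under eq_fun2 do rewrite !hornerC. Qed.

Lemma ratfun_X : ratfun (fun x _ => x).
Proof. by have := ratfun_poly 'X; under eq_fun2 do rewrite hornerX hornerC. Qed.

Lemma ratfun_add f g : ratfun f -> ratfun g ->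
  ratfun (fun x y => f x y + g x y).
Proof.
move=> [u [v [v0 fE]]] [u' [v' [v0' gE]]].
exists (u * v' + u' * v), (v * v'); split; first by rewrite mulf_neq0.
have := generic_and (generic_and fE gE)
  (generic_and (generic_poly v0) (generic_poly v0')).
apply: genericW => x y [[-> ->] [vxy vxy']].
by rewrite !(hornerD, hornerM); field; rewrite vxy vxy'.
Qed.

Lemma ratfun_mul f g : ratfun f -> ratfun g ->
  ratfun (fun x y => f x y * g x y).
Proof.
move=> [u [v [v0 fE]]] [u' [v' [v0' gE]]].
exists (u * u'), (v * v'); split; first by rewrite mulf_neq0.
have := generic_and fE gE.
by apply: genericW => x y [-> ->]; rewrite !hornerM mulf_div.
Qed.

(** With the convention 0^-1 = 0, the inverse is rational even for f = 0. *)
Lemma ratfun_inv f : ratfun f -> ratfun (fun x y => (f x y)^-1).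
Proof.
move=> [u [v [v0 fE]]]; have [u0|u0] := eqVneq u 0.
  exists 0, 1; rewrite oner_neq0; split=> //; apply: genericW fE => x y ->.
  by rewrite u0 !horner0 !mul0r invr0.
by exists v, u; split=> //; apply: genericW fE => x y ->; rewrite invf_div.
Qed.

Lemma ratfun_exp f n : ratfun f -> ratfun (fun x y => f x y ^+ n).
Proof.
move=> rf; elim: n => [|n IH]; first exact: ratfun_cst.
by under eq_fun2 do rewrite exprS; exact: ratfun_mul.
Qed.

Lemma ratfun_mobius (a b c d : F) f : ratfun f ->
  ratfun (fun x y => mobius a b c d (f x y)).
Proof.
move=> rf; apply: ratfun_mul; last apply: ratfun_inv.
  by apply: ratfun_add; [apply: ratfun_mul=> //|]; exact: ratfun_cst.
by apply: ratfun_add; [apply: ratfun_mul=> //|]; exact: ratfun_cst.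
Qed.

(** Leading coefficients show that k = 1 unless p = 0. Then p / q takes the same
    value at all points of an arithmetic progression of step 4 on which q does not
    vanish, so it is constant. *)
Lemma poly_translation_scaling p q (k : F) : q != 0 ->
  (p \Po ('X + 4%:R%:P)) * q = k *: (p * (q \Po ('X + 4%:R%:P))) ->
  exists b, p = b *: q.
Proof.
move=> q0 pq.
have [->|p0] := eqVneq p 0; first by exists 0; rewrite scale0r.
have k1 : k = 1.
  have lcT r : lead_coef (r \Po ('X + 4%:R%:P)) = lead_coef r :> F.
    by rewrite lead_coef_comp ?lead_coefXaddC ?expr1n ?mulr1 // size_XaddC.
  move/(congr1 lead_coef): pq; rewrite lead_coefZ !lead_coefM !lcT.
  move=> /(canLR (mulfK _)) <-; last by rewrite mulf_neq0 ?lead_coef_eq0.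
  by rewrite divff // mulf_neq0 ?lead_coef_eq0.
have step x : p.[x + 4%:R] * q.[x] = p.[x] * q.[x + 4%:R].
  move/(congr1 (horner^~ x)): pq; rewrite k1 scale1r !hornerM !horner_comp.
  by rewrite !hornerE.
have [K qK] := cofinitely_nat (cofinitely_poly q0).
pose b := p.[(4 * K)%:R] / q.[(4 * K)%:R].
have q4 k' : q.[(4 * (K + k'))%:R] != 0.
  by apply: qK; rewrite (leq_trans (leq_addr k' K)) // leq_pmull.
have pb k' : p.[(4 * (K + k'))%:R] = b * q.[(4 * (K + k'))%:R].
  elim: k' => [|k' IH]; first by rewrite addn0 divfK //; have := q4 0%N; rewrite addn0.
  have := step (4 * (K + k'))%:R; rewrite IH -natrD -[X in (_ + X)%N]muln1 -mulnDr.
  rewrite addn1 -addnS mulrAC => /(mulIf (q4 k')) ->; by [].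
exists b; apply/eqP; rewrite -subr_eq0; apply/eqP.
suff : (p - b *: q) \Po (4%:R%:P * 'X) = 0.
  move/(congr1 (comp_poly (4%:R^-1%:P * 'X))); rewrite comp_poly0 -comp_polyA.
  rewrite comp_polyM comp_polyC comp_polyX mulrA -polyCM divff ?pnatr_eq0 //.
  by rewrite mul1r comp_polyXr.
apply: (@poly_eq0_nat _ _ K) => k' /subnKC <-.
rewrite horner_comp !hornerE -natrM pb; ring.
Qed.

(** On almost every horizontal line f is constant by
    [poly_translation_scaling]. Its value there can be read off on one vertical line
    x = x0 that is common to all of them, so it depends rationally on y. *)
Lemma translation_scaling f (k : F) : ratfun f ->
  generically (fun x y => f (x + 4%:R) y = k * f x y) ->
  exists p q, q != 0 /\ generically (fun x y => f x y = p.[y] / q.[y]).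
Proof.
move=> [u [v [v0 fE]]] fT.
have shift (A : F -> F -> Prop) : generically A -> generically (fun x y => A (x + 4%:R) y).
  move=> gA; have := @generic_mobius_pull 1 4%:R 0 1 1 0 A _ _ gA.
  rewrite mulr1 mulr0 subr0 oner_neq0 => /(_ isT isT).
  by apply: genericW => x y; rewrite /mobius !mul1r mul0r add0r !divr1.
have [x0 /cofinitely_ex[y0 vx0]] := cofinitely_ex (generic_fiberX (generic_poly v0)).
have q0 : v.[x0%:P] != 0 by apply: contraNneq vx0 => ->; rewrite horner0.
exists u.[x0%:P], v.[x0%:P]; split=> //.
pose sw (e : {poly {poly F}}) (y : F) := (swapXY e).[y%:P].
have swE e x y : (sw e y).[x] = e.[x, y] by rewrite horner2_swapXY.
have prop : cofinitely (fun y => exists b, sw u y = b *: sw v y).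
  have := generic_and (generic_and fE (shift _ fE))
    (generic_and fT (generic_and (generic_poly v0) (shift _ (generic_poly v0)))).
  move/generic_fiberY; apply: cofinitelyW => y Hy.
  apply: (@poly_translation_scaling _ _ k).
    have [x [_ [_ [vx _]]]] := cofinitely_ex Hy.
    by apply: contraNneq vx => sv0; rewrite -swE sv0 horner0.
  apply: poly_eq_cof; apply: cofinitelyW Hy => x [[f0 f4] [ft [v0x v4x]]].
  rewrite hornerZ !hornerM !horner_comp hornerD hornerX hornerC !swE.
  by move: ft; rewrite f0 f4 mulrA => /eqP; rewrite eqr_div // => /eqP ->; rewrite mulrA.
have := generic_and (generic_cofY prop) (generic_and fE
  (generic_and (generic_poly v0) (generic_cofY (cofinitely_poly q0)))).
apply: genericW => x y [[b uv] [-> [vxy vx0y]]].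
have uE z : u.[z, y] = b * v.[z, y] by rewrite -!(swE _ z) uv hornerZ.
by rewrite !uE !mulfK.
Qed.

End RationalFunctions.

(** * Semiconjugate actions: weights divide *)

Section Semiconjugacy.
Variables (F : numClosedFieldType) (m n : nat).

Lemma pull_scaling (al be ep : F) (A : F -> F -> Prop) :
  al != 0 -> ep != 0 -> generically A ->
  generically (fun x y => A (al * x + be) (ep * y)).
Proof.
move=> al0 ep0 gA; have := @generic_mobius_pull _ al be 0 1 ep 0 A _ ep0 gA.
rewrite mulr1 mulr0 subr0 al0 => /(_ isT).
by apply: genericW => x y; rewrite /mobius mul0r add0r expr0 !divr1.
Qed.

(** What is kept of the pair (M, k = chi_n(M)): the last two clauses record the
    values chi_n(Id) = 1 and chi_n(- Id) = - (- 1)^n through M^2, as M^2 = Id when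
    M is scalar and M^2 = - Id when M has trace zero. *)
Definition multiplier_spec (a b c d k : F) : Prop :=
  [/\ a * d - b * c = 1, k != 0,
      (b = 0 -> c = 0 -> a = d -> (k / d ^+ n) ^+ 2 = 1)
    & (a + d = 0 -> k ^+ 2 * (-1) ^+ n = -1)].

Variables P Q : F -> F -> F.
Hypothesis P_rational : ratfun P.
Hypothesis Q_rational : ratfun Q.
Hypothesis PQ_dominant : forall A, generically A ->
  generically (fun x y => A (P x y) (Q x y)).

(** The source is theta_m(M) when the matrix is M and ep = chi_m(M). The image of M
    is not known, so it is recorded by its entries and its multiplier k. *)
Definition semiconjugates (al be ga de ep : F) : Prop :=
  exists a b c d k, multiplier_spec a b c d k /\
  generically (fun x y =>
    let x' := mobius al be ga de x in let y' := ep * y / (ga * x + de) ^+ m in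
    [/\ c * P x y + d != 0, P x' y' = mobius a b c d (P x y)
      & Q x' y' = k * Q x y / (c * P x y + d) ^+ n]).

Lemma P_avoids (p : {poly F}) : p != 0 -> generically (fun x y => p.[P x y] != 0).
Proof. by move/cofinitely_poly/generic_cofX/PQ_dominant. Qed.

Lemma linear_neq0 (a b : F) : (a != 0) || (b != 0) -> a%:P * 'X + b%:P != 0 :> {poly F}.
Proof.
move=> ab; apply/eqP => p0.
have pE x : a * x + b = 0 by have := horner0 x; rewrite -p0 !hornerE.
have b0 : b = 0 by have := pE 0; rewrite mulr0 add0r.
have a0 : a = 0 by have := pE 1; rewrite b0 mulr1 addr0.
by rewrite a0 b0 eqxx in ab.
Qed.

Lemma P_avoids_linear (a b : F) : (a != 0) || (b != 0) ->
  generically (fun x y => a * P x y + b != 0).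
Proof. by move/linear_neq0/P_avoids; apply: genericW => x y; rewrite !hornerE. Qed.

Lemma Q_neq0 : generically (fun x y => Q x y != 0).
Proof. exact: PQ_dominant (generic_cofY (cofinitely_neq 0)). Qed.

(** The image M of - Id fixes the pair (P, Q) when it acts twice. By
    M^2 = tr(M) M - Id, either M is scalar, so that P is invariant, or tr(M) = 0 and
    M^2 = - Id; in the second case theta_n(M^2) changes the sign of Q, which is
    absurd. *)
Lemma P_even : semiconjugates (-1) 0 0 (-1) (- (-1) ^+ m) ->
  generically (fun x y => P x (- y) = P x y).
Proof.
move=> [a [b [c [d [k [[det k0 _ kN] gH]]]]]].
have {}gH : generically (fun x y => [/\ c * P x y + d != 0,
    P x (- y) = mobius a b c d (P x y)
  & Q x (- y) = k * Q x y / (c * P x y + d) ^+ n]).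
  apply: genericW gH => x y.
  have -> : mobius (-1) 0 0 (-1) x = x.
    by rewrite /mobius mul0r addr0 add0r mulN1r invrN1 mulrN1 opprK.
  have -> // : - (-1) ^+ m * y / (0 * x - 1) ^+ m = - y.
  by rewrite mul0r add0r mulrAC mulNr divff ?signr_eq0 // mulN1r.
have gH' : generically (fun x y => [/\ c * P x (- y) + d != 0,
    P x y = mobius a b c d (P x (- y))
  & Q x y = k * Q x (- y) / (c * P x (- y) + d) ^+ n]).
  have N1 : -1 != 0 :> F by rewrite oppr_eq0 oner_eq0.
  have := pull_scaling 0 (oner_neq0 F) N1 gH; apply: genericW => x y.
  by rewrite mul1r addr0 mulN1r opprK.
have gHH := generic_and gH gH'.
have [tr0|tr0] := eqVneq (a + d) 0.
  have [x [y [[[z0 zE wE] [z0' zE' wE']] w0]]] := generic_ex (generic_and gHH Q_neq0).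
  have jj : (c * P x y + d) * (c * P x (- y) + d) = -1.
    rewrite zE /mobius; have -> : -1 = - (a * d - b * c) by rewrite det.
    have -> : a = - d by apply/eqP; rewrite -addr_eq0 tr0.
    by field.
  have : Q x y = - Q x y.
    rewrite {1}wE' wE.
    have -> : k * (k * Q x y / (c * P x y + d) ^+ n) / (c * P x (- y) + d) ^+ n
      = k ^+ 2 * Q x y / ((c * P x y + d) * (c * P x (- y) + d)) ^+ n.
      by rewrite exprMn; field; rewrite !expf_neq0.
    rewrite jj -signr_odd; have := kN tr0; rewrite -signr_odd => kN'.
    by rewrite invr_sign mulrAC kN' mulN1r.
  move=> /eqP; rewrite -addr_eq0 -mulr2n mulrn_eq0 /= => /eqP w00.
  by rewrite w00 eqxx in w0.
pose r := c%:P * 'X^2 + (d - a)%:P * 'X - b%:P : {poly F}.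
have rE z : r.[z] = c * z ^+ 2 + (d - a) * z - b by rewrite !hornerE.
have r0 : r = 0.
  apply/eqP/negPn/negP => /P_avoids gr.
  have [x [y [[[z0 zE _] [z0' zE' _]]]]] := generic_ex (generic_and gHH gr).
  rewrite rE => /eqP; apply; apply: (mulfI tr0); rewrite mulr0.
  have : P x y * (c * P x (- y) + d) = a * P x (- y) + b.
    by rewrite {1}zE' /mobius divfK.
  rewrite zE /mobius; set z := P x y => h.
  have : (z * (c * ((a * z + b) / (c * z + d)) + d)
     - (a * ((a * z + b) / (c * z + d)) + b)) * (c * z + d) = 0.
    by rewrite h subrr mul0r.
  by move=> <-; field.
have b0 : b = 0.
  have e := rE 0; rewrite r0 horner0 in e.
  by apply/eqP; rewrite -oppr_eq0 e; apply/eqP; ring.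
have c0 : c = 0.
  have e1 := rE 1; have e2 := rE (-1).
  rewrite r0 horner0 b0 in e1; rewrite r0 horner0 b0 in e2.
  have : c *+ 2 = (c * 1 ^+ 2 + (d - a) * 1 - 0)
      + (c * (-1) ^+ 2 + (d - a) * (-1) - 0) by ring.
  by rewrite -e1 -e2 addr0 => /eqP; rewrite mulrn_eq0 => /eqP.
have da : d = a.
  have e1 := rE 1; rewrite r0 horner0 b0 c0 in e1.
  by apply/eqP; rewrite -subr_eq0; apply/eqP; rewrite [RHS]e1; ring.
have a0 : a != 0.
  by apply: contra_eq_neq det => ->; rewrite b0 !mul0r subr0 eq_sym oner_neq0.
apply: genericW gH => x y [_ -> _].
by rewrite /mobius b0 c0 da mul0r addr0 add0r mulrC mulKf.
Qed.

Lemma mobius_det_neq0 (a b c d : F) : a * d - b * c != 0 -> (c != 0) || (d != 0).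
Proof.
by apply: contraNT; rewrite negb_or !negbK => /andP[/eqP -> /eqP ->]; rewrite !mulr0 subrr.
Qed.

(** Moving a fixed point z0 of the transformation to infinity makes it affine. With
    la = c z0 + d an eigenvalue of the matrix, the slope is la^2; for la^2 = 1 the
    translation part is nonzero, as the matrix is not +-Id. *)
Lemma mobius_affine (a b c d : F) : a * d - b * c = 1 ->
  ~ [/\ b = 0, c = 0 & a = d] ->
  exists n1 n2 n3 n4 ka ta : F, [/\ n1 * n4 - n2 * n3 != 0, ka = 1 -> ta != 0 &
    forall z, c * z + d != 0 -> n3 * z + n4 != 0 ->
      mobius n1 n2 n3 n4 (mobius a b c d z) = ka * mobius n1 n2 n3 n4 z + ta].
Proof.
move=> det ns; have [c0|c0] := eqVneq c 0.
  rewrite c0 mulr0 subr0 in det.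
  have d0 : d != 0 by apply: contra_eq_neq det => ->; rewrite mulr0 eq_sym oner_neq0.
  exists 1, 0, 0, 1, (a ^+ 2), (a * b); split; first by rewrite mulr1 mul0r subr0 oner_neq0.
    move=> a1; apply: contra_not_neq ns => /eqP; rewrite mulf_eq0 => ab0.
    have a0 : a != 0 by apply: contra_eq_neq det => ->; rewrite mul0r eq_sym oner_neq0.
    rewrite (negPf a0) in ab0; split; rewrite ?(eqP ab0) //.
    by apply: (mulfI a0); rewrite det -expr2.
  move=> z _ _; rewrite /mobius c0 !mul0r !add0r !addr0 !mul1r !divr1.
  have -> : a = d^-1 by apply: (mulIf d0); rewrite det mulVf.
  by field.
(* the fixed points are the roots of c z^2 + (d - a) z - b *)
pose s := sqrtC ((a - d) ^+ 2 + b * c *+ 4).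
pose z0 := (a - d + s) / (c *+ 2).
have c20 : c *+ 2 != 0 by rewrite mulrn_eq0.
have fix0 : c * z0 ^+ 2 + (d - a) * z0 - b = 0.
  have sE : s ^+ 2 = (a - d) ^+ 2 + b * c *+ 4 by rewrite sqrtCK.
  have -> : c * z0 ^+ 2 + (d - a) * z0 - b
      = (s ^+ 2 - ((a - d) ^+ 2 + b * c *+ 4)) / (c *+ 4).
    by rewrite /z0; field; rewrite c0.
  by rewrite sE subrr mul0r.
pose la := c * z0 + d.
have laV : la * (a - c * z0) = 1.
  rewrite -det /la; apply/eqP; rewrite -subr_eq0; apply/eqP.
  by rewrite -[RHS](mulr0 (- c)) -fix0; ring.
have la0 : la != 0.
  by apply: contra_eq_neq laV => ->; rewrite mul0r eq_sym oner_neq0.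
exists 0, 1, 1, (- z0), (la ^+ 2), (la * c); split.
- by rewrite mul0r mulr1 sub0r oppr_eq0 oner_neq0.
- by move=> _; rewrite mulf_neq0.
move=> z zj zz0; rewrite /mobius !mul0r !add0r !mul1r in zz0 *.
have -> : (a * z + b) / (c * z + d) - z0 = (z - z0) / (la * (c * z + d)).
  have -> : b = c * z0 ^+ 2 + (d - a) * z0.
    by move/eqP: fix0; rewrite subr_eq0 => /eqP ->.
  have -> : (a * z + (c * z0 ^+ 2 + (d - a) * z0))
      = (a - c * z0) * (z - z0) + z0 * (c * z + d).
    by ring.
  have -> : a - c * z0 = la^-1 by apply: (mulfI la0); rewrite laV mulfV.
  by field; rewrite la0 zj.
rewrite invf_div /la; field; exact: zz0.
Qed.

Lemma ratfun_P_mobius (n1 n2 n3 n4 : F) :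
  ratfun (fun x y => mobius n1 n2 n3 n4 (P x y)).
Proof. exact: ratfun_mobius. Qed.

(** If the image of x |-> x + 4 were +-Id, its square would be trivial, against the
    generic injectivity expressed by T. Otherwise P satisfies, in the coordinate of
    [mobius_affine], N(x + 4, y) = ka N + ta. For ka <> 1 the function N plus
    ta / (ka - 1) is a function of y that is multiplied by ka, hence zero: P would
    be constant, against dominance. For ka = 1, N - (ta / 4) x is a function of
    y. *)
Lemma P_linearization (T : F -> F -> F) :
  generically (fun x y => T (P x y) (Q x y) = x) ->
  semiconjugates 1 4%:R 0 1 1 ->
  exists (n1 n2 n3 n4 t : F) (p q : {poly F}), [/\ n1 * n4 - n2 * n3 != 0, t != 0, q != 0 &
    generically (fun x y => n3 * P x y + n4 != 0 /\
      mobius n1 n2 n3 n4 (P x y) = t * x + p.[y] / q.[y])].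
Proof.
move=> TE [a [b [c [d [k [[det k0 kS _] gH]]]]]].
have {}gH : generically (fun x y => [/\ c * P x y + d != 0,
    P (x + 4%:R) y = mobius a b c d (P x y)
  & Q (x + 4%:R) y = k * Q x y / (c * P x y + d) ^+ n]).
  apply: genericW gH => x y.
  by rewrite /mobius mul0r add0r expr1n !mul1r !divr1.
have shift (A : F -> F -> Prop) : generically A -> generically (fun x y => A (x + 4%:R) y).
  move/(pull_scaling 4%:R (oner_neq0 F) (oner_neq0 F)).
  by apply: genericW => x y; rewrite !mul1r.
have [|n1 [n2 [n3 [n4 [ka [ta [N0 kata NE]]]]]]] := mobius_affine det.
  move=> [b0 c0 ad]; have d0 : d != 0.
    by apply: contra_eq_neq det => ->; rewrite c0 !mulr0 subr0 eq_sym oner_neq0.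
  have {}kS := kS b0 c0 ad.
  have g4 : generically (fun x y => P (x + 4%:R) y = P x y
      /\ Q (x + 4%:R) y = k / d ^+ n * Q x y).
    apply: genericW gH => x y [_ -> ->].
    by rewrite /mobius b0 c0 ad mul0r addr0 add0r mulrAC divff // mul1r mulrAC.
  have [x [y [[[p4 q4] [p8 q8]] [t0 t8]]]] := generic_ex (generic_and
    (generic_and g4 (shift _ g4)) (generic_and TE (shift _ (shift _ TE)))).
  move: t8; rewrite p8 q8 p4 q4 mulrA -expr2 kS mul1r t0 => /eqP.
  by rewrite -addrA -subr_eq0 opprD addrA subrr sub0r oppr_eq0 -natrD pnatr_eq0.
pose N x y := mobius n1 n2 n3 n4 (P x y).
have gN : generically (fun x y => n3 * P x y + n4 != 0).
  exact: P_avoids_linear (mobius_det_neq0 N0).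
have NT : generically (fun x y => N (x + 4%:R) y = ka * N x y + ta).
  apply: genericW (generic_and gN gH) => x y [n0 [z0 z4 _]].
  by rewrite /N z4 NE.
have rN : ratfun N by exact: ratfun_P_mobius.
have ka1 : ka = 1.
  apply/eqP/negPn/negP => ka1.
  have {}ka1 : ka - 1 != 0 by rewrite subr_eq0.
  pose si := ta / (ka - 1).
  have [||p [q [q0 pq]]] := @translation_scaling _ (fun x y => N x y + si) ka.
  - by apply: ratfun_add => //; exact: ratfun_cst.
  - by apply: genericW NT => x y ->; rewrite /si; field.
  have av : generically (fun x y => (n1 + si * n3) * P x y + (n2 + si * n4) != 0).
    apply: P_avoids_linear; apply: contraNT N0; rewrite negb_or !negbK.
    move=> /andP[/eqP/(canRL (addrK _)) -> /eqP/(canRL (addrK _)) ->].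
    by apply/eqP; ring.
  have [x [y [[[e1 e4] [n0 av1]] [nT _]]]] := generic_ex (generic_and
    (generic_and (generic_and pq (shift _ pq)) (generic_and gN av)) (generic_and NT NT)).
  have : N x y + si = 0.
    apply: (mulfI ka1); rewrite mulr0 mulrBl mul1r; apply/eqP; rewrite subr_eq0.
    rewrite [X in _ == X]e1 -e4 nT; apply/eqP; rewrite /si; by field.
  have -> : N x y + si
      = ((n1 + si * n3) * P x y + (n2 + si * n4)) / (n3 * P x y + n4).
    by rewrite /N /mobius; field.
  by apply/eqP; rewrite mulf_neq0 // invr_neq0.
pose t := ta / 4%:R.
have f0 : 4%:R != 0 :> F by rewrite pnatr_eq0.
have [||p [q [q0 pq]]] := @translation_scaling _ (fun x y => N x y + - t * x) 1.
- apply: ratfun_add => //; apply: ratfun_mul; first exact: ratfun_cst.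
  exact: ratfun_X.
- apply: genericW NT => x y ->; rewrite ka1 /t; by field.
exists n1, n2, n3, n4, t, p, q; split=> //.
  by rewrite mulf_neq0 ?invr_neq0 // kata.
apply: genericW (generic_and gN pq) => x y [n0 <-]; split=> //.
by rewrite /N; ring.
Qed.

(** The matrix B below is N A adj(N), where A is the image of S and N the
    coordinate change of [P_linearization]: it expresses the action of A on
    t x + h(y). *)
Lemma P_mobius (T : F -> F -> F) (s : F) : s != 0 ->
  generically (fun x y => T (P x y) (Q x y) = x) ->
  semiconjugates 1 4%:R 0 1 1 ->
  semiconjugates (-1) 0 0 (-1) (- (-1) ^+ m) ->
  semiconjugates 0 1 (-1) 0 s ->
  exists e1 f1 e2 f2 : F, e1 * f2 - f1 * e2 != 0 /\
    generically (fun x y => e2 * x + f2 != 0 /\ P x y = mobius e1 f1 e2 f2 x).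
Proof.
move=> s0 TE cT /P_even ev [a [b [c [d [k [[det k0 _ _] gS]]]]]].
have [n1 [n2 [n3 [n4 [t [p [q [N0 t0 q0 gN]]]]]]]] := P_linearization TE cT.
pose h y := p.[y] / q.[y].
have {}gN : generically (fun x y => n3 * P x y + n4 != 0 /\
    mobius n1 n2 n3 n4 (P x y) = t * x + h y) := gN.
have N1 : -1 != 0 :> F by rewrite oppr_eq0 oner_eq0.
have evh : generically (fun x y => h (- y) = h y).
  have := generic_and ev (generic_and gN (pull_scaling 0 (oner_neq0 F) N1 gN)).
  apply: genericW => x y; rewrite mul1r addr0 mulN1r => -[e [[_ e1] [_ e2]]].
  by apply: (addrI (t * x)); rewrite -e2 e e1.
have evm : generically (fun x y => h ((-1) ^+ m * y) = h y).
  apply: genericW evh => x y; rewrite -signr_odd; case: (odd m) => hN.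
    by rewrite expr1 mulN1r.
  by rewrite expr0 mul1r.
pose D := n1 * n4 - n2 * n3.
pose B1 := (n1 * a + n2 * c) * n4 - (n1 * b + n2 * d) * n3.
pose B2 := (n1 * b + n2 * d) * n1 - (n1 * a + n2 * c) * n2.
pose B3 := (n3 * a + n4 * c) * n4 - (n3 * b + n4 * d) * n3.
pose B4 := (n3 * b + n4 * d) * n1 - (n3 * a + n4 * c) * n2.
have detB : B1 * B4 - B2 * B3 = D ^+ 2.
  by rewrite -[RHS]mulr1 -det /B1 /B2 /B3 /B4 /D; ring.
have gE : generically (fun x y => [/\ x != 0, B3 * (t * x + h y) + B4 != 0 &
    t / - x + h (s * y / (- x) ^+ m)
    = mobius B1 B2 B3 B4 (t * x + h y)]).
  have S0 : 0 * 0 - 1 * -1 != 0 :> F by rewrite mulr0 mul1r opprK add0r oner_neq0.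
  have := generic_and (generic_and gN (generic_mobius_pull m S0 s0 gN))
    (generic_and gS (generic_cofX (cofinitely_neq 0))).
  apply: genericW => x y.
  have -> : mobius 0 1 (-1) 0 x = (- x)^-1.
    by rewrite /mobius mul0r add0r mulN1r addr0 mul1r.
  have -> : -1 * x + 0 = - x by rewrite mulN1r addr0.
  move=> [[[z0 <-] [z0' <-]] [[j0 zE _] x0]].
  rewrite zE in z0' *; rewrite /mobius in z0' *.
  set z := P x y in z0 j0 z0' *.
  have B0 : (n3 * a + n4 * c) * z + (n3 * b + n4 * d) != 0.
    move: z0'; rewrite (_ : n3 * _ + n4
      = ((n3 * a + n4 * c) * z + (n3 * b + n4 * d)) / (c * z + d)); last by field.
    by rewrite mulf_eq0 negb_or => /andP[].
  have BE : B3 * ((n1 * z + n2) / (n3 * z + n4)) + B4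
      = D * ((n3 * a + n4 * c) * z + (n3 * b + n4 * d)) / (n3 * z + n4).
    by rewrite /B3 /B4 /D; field.
  rewrite BE; split=> //.
    by rewrite mulf_neq0 ?invr_neq0 // mulf_neq0.
  by rewrite /B1 /B2 /D; field; rewrite z0 B0 N0 j0.
(* the equation [gE] at (x, y) minus the one at (- x, (- 1)^m y) *)
have gB : generically (fun x y =>
    (B3 * h y + B4) ^+ 2 - B3 ^+ 2 * t ^+ 2 * x ^+ 2 = - D ^+ 2 * x ^+ 2).
  have sg : (-1) ^+ m != 0 :> F by rewrite signr_eq0.
  have := generic_and evm (generic_and gE (pull_scaling 0 N1 sg gE)).
  apply: genericW => x y; rewrite mulN1r addr0 opprK => -[hm [[x0 j1 e1] [_ j2 e2]]].
  have ym : s * ((-1) ^+ m * y) / x ^+ m = s * y / (- x) ^+ m.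
    rewrite [in RHS]exprNn -{2}[(-1) ^+ m]signr_odd invfM invr_sign signr_odd.
    by ring.
  rewrite ym hm in e2; rewrite hm in j2.
  have e3 : t / x + t / x = mobius B1 B2 B3 B4 (t * - x + h y)
      - mobius B1 B2 B3 B4 (t * x + h y).
    by rewrite -e1 -e2 invrN; ring.
  have e4 : mobius B1 B2 B3 B4 (t * - x + h y) - mobius B1 B2 B3 B4 (t * x + h y)
     = - (D ^+ 2) * (t * x *+ 2)
       / ((B3 * (t * - x + h y) + B4) * (B3 * (t * x + h y) + B4)).
    by rewrite -detB /mobius; field; rewrite j1 j2.
  rewrite e4 in e3.
  have -> : (B3 * h y + B4) ^+ 2 - B3 ^+ 2 * t ^+ 2 * x ^+ 2
     = (B3 * (t * - x + h y) + B4) * (B3 * (t * x + h y) + B4) by ring.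
  set K := _ * (B3 * _ + B4) in e3 *.
  have K0 : K != 0 by rewrite mulf_neq0.
  have t20 : t *+ 2 != 0 by rewrite mulrn_eq0.
  apply: (mulfI t20).
  have -> : t *+ 2 * K = (t / x + t / x) * (x * K) by field.
  by rewrite e3; field.
have hE y : cofinitely (fun x => (B3 * h y + B4) ^+ 2 - B3 ^+ 2 * t ^+ 2 * x ^+ 2
    = - D ^+ 2 * x ^+ 2) -> B3 * h y + B4 = 0 /\ B3 != 0.
  set K := B3 * h y + B4 => gK.
  have rE : ((K ^+ 2)%:P + (D ^+ 2 - B3 ^+ 2 * t ^+ 2)%:P * 'X^2 : {poly F}) = 0.
    apply: poly_eq0_cof; apply: cofinitelyW gK => x e.
    rewrite !(hornerD, hornerM, hornerC, hornerX).
    have -> : K ^+ 2 = - D ^+ 2 * x ^+ 2 + B3 ^+ 2 * t ^+ 2 * x ^+ 2.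
      by rewrite -e subrK.
    by ring.
  have rx x : K ^+ 2 + (D ^+ 2 - B3 ^+ 2 * t ^+ 2) * (x * x) = 0.
    by rewrite -[RHS](horner0 x) -rE !(hornerD, hornerM, hornerC, hornerX).
  have K0 : K = 0.
    by have /eqP := rx 0; rewrite !mulr0 addr0 sqrf_eq0 => /eqP.
  split=> //; apply: contraNneq N0 => B30.
  have := rx 1; rewrite K0 B30 !expr0n /= mul0r subr0 add0r !mulr1.
  by move/eqP; rewrite sqrf_eq0.
have {hE} := generic_cofY (cofinitelyW hE (generic_fiberY gB)).
move=> gh; have [x0 [y0 [_ B30]]] := generic_ex gh.
pose b0 := - B4 / B3.
exists (n4 * t), (n4 * b0 - n2), (- n3 * t), (n1 - n3 * b0); split.
  have -> : n4 * t * (n1 - n3 * b0) - (n4 * b0 - n2) * (- n3 * t) = t * D.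
    by rewrite /D; ring.
  by rewrite mulf_neq0.
apply: genericW (generic_and gN gh) => x y [[z0 zE] [hy _]].
have hb : h y = b0.
  apply: (mulfI B30); rewrite /b0 [RHS]mulrCA mulfV // mulr1.
  by apply/eqP; rewrite -addr_eq0 hy.
rewrite hb /mobius in zE.
set z := P x y in z0 zE *.
have jE : - n3 * t * x + (n1 - n3 * b0) = D / (n3 * z + n4).
  have -> : - n3 * t * x + (n1 - n3 * b0) = n1 - n3 * (t * x + b0) by ring.
  by rewrite -zE /D; field.
rewrite /mobius jE; split; first by rewrite mulf_neq0 ?invr_neq0.
have -> : n4 * t * x + (n4 * b0 - n2) = n4 * (t * x + b0) - n2 by ring.
by rewrite -zE /D; field; rewrite z0 N0.
Qed.

(** Cramer's rule applied to the coefficients of 1, x and x^2; the factor l relates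
    two automorphy factors. *)
Lemma linear_proportional (u1 u0 v1 v0 i1 i0 j1 j0 : F) :
  i1 * j0 - i0 * j1 != 0 ->
  cofinitely (fun x => (u1 * x + u0) * (j1 * x + j0) = (v1 * x + v0) * (i1 * x + i0)) ->
  exists l, v1 = l * j1 /\ v0 = l * j0.
Proof.
move=> D0 cE.
pose r := (u1 * j1 - v1 * i1)%:P * 'X^2
  + (u1 * j0 + u0 * j1 - v1 * i0 - v0 * i1)%:P * 'X + (u0 * j0 - v0 * i0)%:P : {poly F}.
have rE x : r.[x] = (u1 * x + u0) * (j1 * x + j0) - (v1 * x + v0) * (i1 * x + i0).
  by rewrite !(hornerD, hornerM, hornerC, hornerX); ring.
have r0 : r = 0.
  by apply: poly_eq0_cof; apply: cofinitelyW cE => x e; rewrite rE e subrr.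
have rc i : r`_i = 0 by rewrite r0 coef0.
have c0 : u0 * j0 = v0 * i0.
  apply/eqP; rewrite -subr_eq0 -[X in _ == X](rc 0%N).
  by rewrite !coefD !coefCM coefXn coefX coefC /= !mulr0 !add0r.
have c1 : u1 * j0 + u0 * j1 = v1 * i0 + v0 * i1.
  apply/eqP; rewrite -subr_eq0 opprD addrA -[X in _ == X](rc 1%N).
  by rewrite !coefD !coefCM coefXn coefX coefC /= mulr0 mulr1 add0r addr0.
have c2 : u1 * j1 = v1 * i1.
  apply/eqP; rewrite -subr_eq0 -[X in _ == X](rc 2%N).
  by rewrite !coefD !coefCM coefXn coefX coefC /= mulr0 mulr1 !addr0.
exists ((u1 * j0 - v1 * i0) / (i1 * j0 - i0 * j1)).
split; apply: (mulIf D0); rewrite mulrAC divfK //.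
  have -> : v1 * (i1 * j0 - i0 * j1) = (v1 * i1) * j0 - v1 * i0 * j1 by ring.
  by rewrite -c2; ring.
have -> : v0 * (i1 * j0 - i0 * j1) = (v0 * i1) * j0 - v0 * i0 * j1 by ring.
have -> : v0 * i1 = u1 * j0 + u0 * j1 - v1 * i0 by rewrite c1; ring.
by rewrite -c0; ring.
Qed.

(** The cocycle c' P + d' differs from c x + d by a coboundary and a
    constant: with J = e2 x + f2,
    it equals l (c x + d) J(M x) / J(x) for a constant l. Multiplying Q by J^n
    therefore turns the factor (c' P + d')^n into (c x + d)^n. *)
Lemma semi_invariant (e1 f1 e2 f2 al be ga de ep : F) :
  e1 * f2 - f1 * e2 != 0 -> al * de - be * ga != 0 -> ep != 0 ->
  generically (fun x y => e2 * x + f2 != 0 /\ P x y = mobius e1 f1 e2 f2 x) ->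
  semiconjugates al be ga de ep ->
  let beta x y := Q x y * (e2 * x + f2) ^+ n in
  exists2 ka, ka != 0 & generically (fun x y =>
    beta (mobius al be ga de x) (ep * y / (ga * x + de) ^+ m)
    = ka * beta x y / (ga * x + de) ^+ n).
Proof.
move=> D0 M0 ep0 gP [a [b [c [d [k [[det k0 _ _] gH]]]]]] beta.
have j0 : generically (fun x y => ga * x + de != 0).
  have := generic_cofX (cofinitely_poly (linear_neq0 (mobius_det_neq0 M0))).
  by apply: genericW => x y; rewrite !hornerE.
have gA := generic_and (generic_and gP (generic_mobius_pull m M0 ep0 gP))
  (generic_and gH j0).
pose v1 := c * e1 + d * e2; pose v0 := c * f1 + d * f2.
have jM x : ga * x + de != 0 -> e2 * mobius al be ga de x + f2
    = ((e2 * al + f2 * ga) * x + (e2 * be + f2 * de)) / (ga * x + de).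
  by move=> jx; rewrite /mobius; field.
have [||l [vl1 vl0]] := @linear_proportional (a * e1 + b * e2) (a * f1 + b * f2) v1 v0
  (e1 * al + f1 * ga) (e1 * be + f1 * de) (e2 * al + f2 * ga) (e2 * be + f2 * de).
- have -> : (e1 * al + f1 * ga) * (e2 * be + f2 * de)
     - (e1 * be + f1 * de) * (e2 * al + f2 * ga)
     = (e1 * f2 - f1 * e2) * (al * de - be * ga).
    by ring.
  by rewrite mulf_neq0.
- have [y Hy] := cofinitely_ex (generic_fiberY gA).
  apply: cofinitelyW Hy => x [[[z0 zE] [z0' zE']] [[jz zz _] jx]].
  rewrite zE' zE in zz; rewrite zE in jz; rewrite jM // in z0'.
  have V0 : v1 * x + v0 != 0.
    move: jz; rewrite /mobius (_ : _ + d = (v1 * x + v0) / (e2 * x + f2)).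
      by rewrite mulf_eq0 negb_or => /andP[].
    by rewrite /v1 /v0; field.
  have J0 : (e2 * al + f2 * ga) * x + (e2 * be + f2 * de) != 0.
    by move: z0'; rewrite mulf_eq0 negb_or => /andP[].
  have EL : mobius e1 f1 e2 f2 (mobius al be ga de x)
      = ((e1 * al + f1 * ga) * x + (e1 * be + f1 * de))
      / ((e2 * al + f2 * ga) * x + (e2 * be + f2 * de)).
    rewrite {1}/mobius jM // /mobius; field; by rewrite jx J0.
  have ER : mobius a b c d (mobius e1 f1 e2 f2 x)
      = ((a * e1 + b * e2) * x + (a * f1 + b * f2)) / (v1 * x + v0).
    rewrite /mobius /v1 /v0.
    by field; rewrite z0 andbT.
  move/eqP: zz; rewrite EL ER eqr_div // => /eqP <-; exact: mulrC.
have cPd x : e2 * x + f2 != 0 -> ga * x + de != 0 -> c * mobius e1 f1 e2 f2 x + d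
    = l * (ga * x + de) * (e2 * mobius al be ga de x + f2) / (e2 * x + f2).
  move=> z0 jx; rewrite jM //.
  have -> : c * mobius e1 f1 e2 f2 x + d = (v1 * x + v0) / (e2 * x + f2).
    by rewrite /mobius /v1 /v0; field.
  by rewrite vl1 vl0; field; rewrite z0 jx.
have l0 : l != 0.
  have [x [y [[[z0 zE] _] [[jz _ _] jx]]]] := generic_ex gA.
  by apply: contraNneq jz => l0; rewrite zE cPd // l0 !mul0r.
exists (k / l ^+ n); first by rewrite mulf_neq0 ?invr_neq0 ?expf_neq0.
apply: genericW gA => x y [[[z0 zE] [z0' zE']] [[jz _ qE] jx]].
rewrite /beta qE zE cPd // !exprMn exprVn; field.
by rewrite !expf_neq0.
Qed.

(** The function beta of [semi_invariant] is p / q as a function of y. With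
    x = - 1 / u the relation for S becomes p(c1 u^m) = c2 u^n q(c1 u^m), and
    m deg p = n + m deg q. *)
Lemma weight_divides (T : F -> F -> F) (s : F) : s != 0 ->
  generically (fun x y => T (P x y) (Q x y) = x) ->
  semiconjugates 1 4%:R 0 1 1 ->
  semiconjugates (-1) 0 0 (-1) (- (-1) ^+ m) ->
  semiconjugates 0 1 (-1) 0 s ->
  (m %| n)%N.
Proof.
move=> s0 TE cT cI cS.
have [e1 [f1 [e2 [f2 [D0 gP]]]]] := P_mobius s0 TE cT cI cS.
have T0 : 1 * 1 - 4%:R * 0 != 0 :> F by rewrite mulr0 subr0 mulr1 oner_neq0.
have S0 : 0 * 0 - 1 * -1 != 0 :> F by rewrite mulr0 mul1r opprK add0r oner_neq0.
have [ka _ gT] := semi_invariant D0 T0 (oner_neq0 F) gP cT.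
have [la la0 gS] := semi_invariant D0 S0 s0 gP cS.
set beta := fun x y => Q x y * (e2 * x + f2) ^+ n.
have [||p [q [q0 gb]]] := @translation_scaling _ beta ka.
- apply: ratfun_mul => //; apply: ratfun_exp; apply: ratfun_add; last exact: ratfun_cst.
  by apply: ratfun_mul; [exact: ratfun_cst | exact: ratfun_X].
- apply: genericW gT => x y.
  by rewrite /beta /mobius mul0r add0r !expr1n !mul1r !divr1.
have gS' : generically (fun x y => beta ((- x)^-1) (s * y / (- x) ^+ m)
    = la * beta x y / (- x) ^+ n).
  apply: genericW gS => x y.
  by rewrite /beta /mobius mul0r add0r mulN1r addr0 mul1r.
have gb0 : generically (fun x y => beta x y != 0).
  apply: genericW (generic_and gP Q_neq0) => x y [[z0 _] w0].
  by rewrite mulf_neq0 // expf_neq0.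
have gbS := generic_mobius_pull m S0 s0
  (generic_and gb (generic_cofY (cofinitely_poly q0))).
have [y1 /(cofinitely_inj (@opprK F))/(cofinitely_inj (@invrK F)) cx] :=
  cofinitely_ex (generic_fiberY (generic_and (generic_and gS' gb0)
    (generic_and (generic_and gb gbS) (generic_cofY (cofinitely_neq 0))))).
pose c1 := s * y1; pose c2 := la * (p.[y1] / q.[y1]).
have {}cx : cofinitely (fun u => [/\ c1 != 0, c2 != 0, q.[c1 * u ^+ m] != 0 &
    p.[c1 * u ^+ m] = c2 * u ^+ n * q.[c1 * u ^+ m]]).
  apply: cofinitelyW (cofinitely_and cx (cofinitely_neq 0)) => u.
  rewrite /mobius mul0r add0r mulN1r addr0 !opprK !invrK mul1r exprVn invrK.
  move=> [[[eS b0] [[eb [ebS qn]] y10]] u0].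
  move: eS; rewrite exprVn invrK ebS eb => /(canRL (divfK qn)) ->.
  by rewrite eb in b0; split=> //; exact: mulf_neq0.
pose c1X : {poly F} := c1%:P * 'X^m.
have [u1 [c10 c20 qu _]] := cofinitely_ex cx.
have pq : p \Po c1X = c2%:P * 'X^n * (q \Po c1X).
  apply: poly_eq_cof; apply: cofinitelyW cx => u [_ _ _ e].
  by rewrite !hornerM !horner_comp !hornerE e.
have qc0 : q \Po c1X != 0.
  apply: contraNneq qu => /(congr1 (horner^~ u1)).
  by rewrite horner_comp !hornerE => ->.
have sc : (size c1X).-1 = m.
  by rewrite /c1X mul_polyC size_scale // size_polyXn.
have : ((size p).-1 * m = n + (size q).-1 * m)%N.
  rewrite -[in LHS]sc -size_comp_poly pq mulrAC size_mulXn ?mulf_neq0 ?polyC_eq0 //.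
  rewrite mul_polyC size_scale // -[X in (_ = _ + _ * X)%N]sc -size_comp_poly.
  by rewrite -subn1 addnC -addnBAC ?size_poly_gt0 // subn1 addnC.
move=> e; have : (m %| n + (size q).-1 * m)%N by rewrite -e dvdn_mull.
by rewrite dvdn_addl // dvdn_mull.
Qed.

End Semiconjugacy.

(** * Zariski topology of the projective plane *)

Section Polynomials.
Variables (R : realType) (N : nat).
Local Notation C := R[i].

Lemma function_algebra_peval (T : Type) (alg : (T -> C) -> Prop) (w : T -> 'rV[C]_N)
    (e : {mpoly C[N]}) :
  function_algebra alg -> (forall j, alg (fun t => w t 0 j)) ->
  alg (fun t => peval e (w t)).
Proof.
move=> [algC algD algM] aw; rewrite /peval.
have ext f g : f =1 g -> alg f -> alg g by move=> /funext ->.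
have algX f k : alg f -> alg (fun t => f t ^+ k).
  move=> af; elim: k => [|k IH]; first by apply: ext (algC 1).
  by apply: ext (algM _ _ af IH) => t; rewrite exprS.
have algP (f : 'I_N -> T -> C) : (forall j, alg (f j)) -> alg (fun t => \prod_j f j t).
  move=> af; elim: (index_enum _) => [|j s IH].
    by apply: ext (algC 1) => t; rewrite big_nil.
  by apply: ext (algM _ _ (af j) IH) => t; rewrite big_cons.
suff h s : alg (fun t => \sum_(m <- s) e@_m * \prod_i w t 0 i ^+ m i).
  by apply: ext (h (msupp e)) => t; rewrite mevalE.
elim: s => [|m s IH]; first by apply: ext (algC 0) => t; rewrite big_nil.
apply: ext (algD _ _ (algM _ _ (algC e@_m) (algP (fun i t => w t 0 i ^+ m i) _)) IH).
  by move=> t; rewrite big_cons.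
by move=> j; exact: algX.
Qed.

Lemma pevalD (e1 e2 : {mpoly C[N]}) v : peval (e1 + e2) v = peval e1 v + peval e2 v.
Proof. exact: mevalD. Qed.
Lemma pevalM (e1 e2 : {mpoly C[N]}) v : peval (e1 * e2) v = peval e1 v * peval e2 v.
Proof. exact: mevalM. Qed.
Lemma pevalC (c : C) v : peval c%:MP_[N] v = c.
Proof. exact: mevalC. Qed.
Lemma pevalX (j : 'I_N) (v : 'rV[C]_N) : peval 'X_j v = v 0 j.
Proof. exact: mevalXU. Qed.

Definition peval_algebra (M : nat) : ('rV[C]_M -> C) -> Prop :=
  fun f => exists e : {mpoly C[M]}, forall v, f v = peval e v.

End Polynomials.

Section PolynomialMaps.
Variable R : realType.
Local Notation C := R[i].

Lemma peval_algebraP M : function_algebra (@peval_algebra R M).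
Proof.
split=> [c|f g [p hp] [q hq]|f g [p hp] [q hq]].
- by exists c%:MP_[M] => v; rewrite pevalC.
- by exists (p + q) => v; rewrite pevalD hp hq.
- by exists (p * q) => v; rewrite pevalM hp hq.
Qed.

Lemma peval_algebra_coord M j : @peval_algebra R M (fun v => v 0 j).
Proof. by exists 'X_j => v; rewrite pevalX. Qed.

Lemma dehomogenize (e : {mpoly C[3]}) :
  exists d : {poly {poly C}}, forall x y, d.[x, y] = peval e (hvec x y).
Proof.
pose alg (f : C * C -> C) := exists d : {poly {poly C}}, forall t, f t = d.[t.1, t.2].
have [||d hd] := @function_algebra_peval R 3 _ alg (fun t => hvec t.1 t.2) e.
- split=> [c|f g [u hu] [v hv]|f g [u hu] [v hv]].
  + by exists c%:P%:P => t; rewrite !hornerC.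
  + by exists (u + v) => t; rewrite !hornerD hu hv.
  + by exists (u * v) => t; rewrite !hornerM hu hv.
- case=> [[|[|[|//]]] jP].
  + by exists 'X => t; rewrite !mxE /= hornerX hornerC.
  + by exists 'X%:P => t; rewrite !mxE /= hornerC hornerX.
  + by exists 1%:P%:P => t; rewrite !mxE /= !hornerC.
- by exists d => x y; rewrite -(hd (x, y)).
Qed.

Lemma homogenize (d : {poly {poly C}}) : exists (e : {mpoly C[3]}) (N : nat),
  forall v : 'rV[C]_3, v 0 2%:R != 0 ->
  peval e v = v 0 2%:R ^+ N * d.[v 0 0 / v 0 2%:R, v 0 1 / v 0 2%:R].
Proof.
have [E [N [[e Ee] hE]]] := clear_denominators (@peval_algebraP 3)
  (peval_algebra_coord 0) (peval_algebra_coord 1) (peval_algebra_coord 2%:R) d.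
by exists e, N => v v2; rewrite -Ee hE.
Qed.

(** On the line through v in the direction of the third coordinate, e restricts to
    a nonzero polynomial in one variable. *)
Lemma peval_neq0_off_line (e : {mpoly C[3]}) v : peval e v != 0 ->
  exists w : 'rV[C]_3, w 0 2%:R != 0 /\ peval e w != 0.
Proof.
move=> ev0.
pose w t : 'rV[C]_3 := v + t *: delta_mx 0 2%:R.
have wE t j : w t 0 j = v 0 j + t * (j == 2%:R)%:R.
  by rewrite !mxE eqxx /=.
pose alg (f : C -> C) := exists p : {poly C}, forall t, f t = p.[t].
have [||p hp] := @function_algebra_peval R 3 _ alg w e.
- split=> [c|f g [p hp] [q hq]|f g [p hp] [q hq]].
  + by exists c%:P => t; rewrite hornerC.
  + by exists (p + q) => t; rewrite hornerD hp hq.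
  + by exists (p * q) => t; rewrite hornerM hp hq.
- by move=> j; exists ((v 0 j)%:P + 'X * ((j == 2%:R)%:R)%:P) => t; rewrite wE !hornerE.
have p0 : p != 0.
  apply: contraNneq ev0 => p0; have := hp 0.
  by rewrite p0 horner0 /w scale0r addr0 => ->.
have [t [pt tv]] := cofinitely_ex (cofinitely_and (cofinitely_poly p0)
  (cofinitely_neq (- v 0 2%:R))).
exists (w t); rewrite hp wE eqxx mulr1; split=> //.
by rewrite addrC addr_eq0.
Qed.

End PolynomialMaps.

Section Plane.
Variable R : realType.
Local Notation C := R[i].
Local Notation P2 := (P2 R).
Implicit Types (U V : set P2) (p : P2).

Lemma preim_piE N (A : pred 'rV[C]_N) (e : equiv_rel {v : 'rV[C]_N | A v})
    (U : set {eq_quot e}) (a : {v : 'rV[C]_N | A v}) :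
  preim_pi U (val a) <-> U (\pi_{eq_quot e} a).
Proof.
split=> [[b Ub /val_inj <-] //|Ua]; by exists a.
Qed.

Lemma preim_hvec U x y : preim_pi U (hvec x y) <-> U (affine_pt x y).
Proof. exact: (preim_piE _ (exist (fun v => P2_cone v) _ (hvec_cone x y))). Qed.

Lemma pi_P2 (a : {v : 'rV[C]_3 | P2_cone v}) (v := val a) : v 0 2%:R != 0 ->
  \pi_{eq_quot (P2_equiv R)} a = affine_pt (v 0 0 / v 0 2%:R) (v 0 1 / v 0 2%:R).
Proof.
move=> v2; apply/eqmodP/asboolP; exists (v 0 2%:R)^-1; rewrite ?invr_neq0 //.
apply/rowP => j; rewrite !mxE.
have [->|->|->] : [\/ j = 0, j = 1 | j = 2%:R].
- case: j => [[|[|[|//]]] jP]; [apply: Or31|apply: Or32|apply: Or33]; exact: val_inj.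
- by rewrite /= mulrC.
- by rewrite /= mulrC.
- by rewrite /= mulVf.
Qed.

Lemma pi_affine_pt (a : {v : 'rV[C]_3 | P2_cone v}) x y :
  \pi_{eq_quot (P2_equiv R)} a = affine_pt x y ->
  exists2 l, l != 0 & val a = l *: hvec x y.
Proof.
by move=> /esym/eqmodP/asboolP [l l0 /= E]; exists l.
Qed.

Definition affine_open (d : {poly {poly C}}) : set P2 :=
  [set p | exists x y, p = affine_pt x y /\ d.[x, y] != 0].

(** The polynomial that homogenizes d is multiplied by the third coordinate, which
    removes the line at infinity. *)
Lemma zopen_affine_open d : zopen (affine_open d).
Proof.
have [e [N eE]] := homogenize d.
exists [set e * 'X_2%:R]; apply/seteqP; split => v.
  move=> [a [x [y [E dxy]]] <-] /=; exists (e * 'X_2%:R) => //.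
  have [l l0 ->] := pi_affine_pt E.
  rewrite pevalM pevalX !mxE /= mulr1 mulf_neq0 //.
  rewrite eE !mxE /= ?mulr1 // ![l * _]mulrC !mulfK //.
  by rewrite mulf_neq0 // expf_neq0.
move=> [_ ->]; rewrite pevalM pevalX mulf_eq0 negb_or => /andP[ev v2].
have vc : P2_cone v.
  by apply: contraNneq v2 => ->; rewrite mxE.
exists (exist (fun v => P2_cone v) v vc) => //.
exists (v 0 0 / v 0 2%:R), (v 0 1 / v 0 2%:R); split; first exact: pi_P2.
by move: ev; rewrite eE // mulf_eq0 negb_or => /andP[].
Qed.

(** One of the polynomials e that define the cone over U is nonzero at a point with
    nonzero third coordinate. This point is rescaled to lie on the plane z = 1; as
    e need not be homogeneous, another defining polynomial e' may be needed
    there. *)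
Lemma zopen_generic U : zopen U -> U !=set0 ->
  generically (fun x y => U (affine_pt x y)).
Proof.
move=> [S SE] [p Up].
have preimP v : preim_pi U v <-> exists2 e, S e & peval e v != 0 by rewrite SE.
have : preim_pi U (hrepr p) by apply/preim_piE; rewrite reprK.
move=> /preimP[e Se /peval_neq0_off_line[w [w2 ew]]].
have /preimP [a Ua aw] : exists2 e, S e & peval e w != 0 by exists e.
have hU : preim_pi U (hvec (w 0 0 / w 0 2%:R) (w 0 1 / w 0 2%:R)).
  apply/preim_hvec.
  by have := @pi_P2 a; rewrite aw => <-.
have [e' Se' e'0] := (preimP _).1 hU.
have [d dE] := dehomogenize e'; exists d.
  by apply: contraNneq e'0 => d0; rewrite -dE d0 !horner0.
move=> x y; rewrite dE => exy.
apply/preim_hvec.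
by apply/preimP; exists e'.
Qed.

(** A regular function is a fraction of polynomials near one affine point, hence
    generically. *)
Lemma regular_ratfun U (g : P2 -> C) : zopen U -> U !=set0 -> regular U g ->
  ratfun (fun x y => g (affine_pt x y)).
Proof.
move=> oU nU [f fr fg].
have [x0 [y0 U0]] := generic_ex (zopen_generic oU nU).
have /fr [V [p [q [[S SE] V0 VU fE]]]] : preim_pi U (hvec x0 y0).
  by apply/preim_hvec.
have VP v : V v <-> exists2 e, S e & peval e v != 0 by rewrite SE.
have [e Se e0] := (VP _).1 V0.
have [d dE] := dehomogenize e.
have [u uE] := dehomogenize p.
have [v vE] := dehomogenize q.
exists u, v; split.
  apply: contraNneq (fE _ V0).1 => v0; by rewrite -vE v0 !horner0.
exists d; first by apply: contraNneq e0 => d0; rewrite -dE d0 !horner0.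
move=> x y; rewrite dE => exy.
have Vxy : V (hvec x y) by apply/VP; exists e.
have [_ fxy] := fE _ Vxy; rewrite uE vE -fxy.
rewrite -(fg (exist (fun v => P2_cone v) _ (hvec_cone x y))) //.
by apply/preim_hvec; exact: VU.
Qed.

Lemma regular_coord (j : 'I_3) :
  regular (affine_open 1) (fun p => hrepr p 0 j / hrepr p 0 2%:R).
Proof.
have v2 v : preim_pi (affine_open 1) v -> v 0 2%:R != 0.
  by move=> [a [x [y [/pi_affine_pt[l l0 E] _]]] <-]; rewrite E !mxE /= mulr1.
exists (fun v => v 0 j / v 0 2%:R).
  move=> v Av; exists (preim_pi (affine_open 1)), 'X_j, 'X_2%:R; split=> //.
    exact: zopen_affine_open.
  by move=> w /v2 w2; rewrite !pevalX.
move=> a [x [y [E _]]]; have [l l0 ->] := pi_affine_pt E.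
have [m m0 ->] : exists2 m, m != 0 &
    hrepr (\pi_{eq_quot (P2_equiv R)} a : P2) = m *: hvec x y.
  by apply: pi_affine_pt; rewrite reprK.
have scE k : k != 0 -> (k *: hvec x y) 0 j / (k *: hvec x y) 0 2%:R = [:: x; y; 1]`_j.
  by move=> k0; rewrite !mxE /= mulr1 mulrC mulKf.
by rewrite !scE.
Qed.

Definition xpart (f : pmap P2 P2) x y : C := xcoord (f (affine_pt x y)).
Definition ypart (f : pmap P2 P2) x y : C := ycoord (f (affine_pt x y)).

Section Dominant.
Variables f g : pmap P2 P2.
Hypotheses (f_rational : is_rational f) (fgK : rat_eq (pcomp f g) (pid P2)).

(** The preimage is nonempty because W meets the open set on which f o g is the
    identity. *)
Lemma dominant_preimage W : zopen W -> W !=set0 ->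
  zopen (pdom f `&` f @^-1` W) /\ (pdom f `&` f @^-1` W) !=set0.
Proof.
have [_ _ freg] := f_rational; have [U [oU nU Udom UE]] := fgK.
move=> oW nW; split; first exact: (freg W oW).1.
have [x [y [Up Wp]]] :=
  generic_ex (generic_and (zopen_generic oU nU) (zopen_generic oW nW)).
exists (g (affine_pt x y)); have [[_ fg] _] := Udom _ Up.
by split=> //=; have /= -> := UE _ Up.
Qed.

Lemma dominant_generic (A : C -> C -> Prop) : generically A ->
  generically (fun x y => f (affine_pt x y) = affine_pt (xpart f x y) (ypart f x y)
                          /\ A (xpart f x y) (ypart f x y)).
Proof.
move=> [d d0 dA].
have nd : affine_open d !=set0.
  have [x [y dxy]] := generic_ex (generic_poly d0).
  by exists (affine_pt x y), x, y.
have [o n] := dominant_preimage (zopen_affine_open d) nd.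
apply: genericW (zopen_generic o n) => x y [_ [x' [y' [E dxy]]]].
rewrite /xpart /ypart E; have [-> ->] := affine_ptK x' y'.
by split=> //; exact: dA.
Qed.

Lemma dominant_ratfun : ratfun (xpart f) /\ ratfun (ypart f).
Proof.
have n1 : affine_open 1 !=set0.
  by exists (affine_pt 0 0), 0, 0; rewrite !hornerC oner_neq0.
have [o n] := dominant_preimage (zopen_affine_open 1) n1.
have [_ _ freg] := f_rational.
have reg j := (freg _ (zopen_affine_open 1)).2 _ (regular_coord j).
split; first exact: (regular_ratfun (g := fun p => xcoord (f p)) o n (reg 0)).
exact: (regular_ratfun (g := fun p => ycoord (f p)) o n (reg 1)).
Qed.

End Dominant.

Lemma rat_eq_generic (a b : pmap P2 P2) : rat_eq a b ->
  generically (fun x y => a (affine_pt x y) = b (affine_pt x y)).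
Proof.
by move=> [U [oU nU _ UE]]; apply: genericW (zopen_generic oU nU) => x y /UE.
Qed.

End Plane.

(** * The characters at T, S and - Id *)

Section Characters.
Variable R : realType.
Local Notation C := R[i].

Lemma mx2E a b c d : (mx2 a b c d 0 0 = a) * (mx2 a b c d 0 1 = b) *
  (mx2 a b c d 1 0 = c) * (mx2 a b c d 1 1 = d).
Proof. by rewrite !mxE. Qed.

Lemma mx2_eta (M : 'M[int]_2) : M = mx2 (M 0 0) (M 0 1) (M 1 0) (M 1 1).
Proof.
apply/matrixP => i j; rewrite !mxE.
have I2 (k : 'I_2) : k = 0 \/ k = 1.
  by case: k => [[|[|//]] kP]; [left|right]; exact: val_inj.
by have [->|->] := I2 i; have [->|->] := I2 j.
Qed.

Lemma mx2M a b c d a' b' c' d' : mx2 a b c d *m mx2 a' b' c' d'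
  = mx2 (a * a' + b * c') (a * b' + b * d') (c * a' + d * c') (c * b' + d * d').
Proof.
rewrite [LHS]mx2_eta !mxE !big_ord_recl !big_ord0 !addr0 !mxE.
by have -> : lift ord0 ord0 = 1 :> 'I_2 by apply: val_inj.
Qed.

Lemma det_mx2 a b c d : \det (mx2 a b c d) = a * d - b * c.
Proof.
rewrite (expand_det_row _ 0) !big_ord_recl big_ord0.
by rewrite /cofactor !det_mx11 !mxE /= expr0 expr1 mul1r mulN1r mulrN addr0.
Qed.

Lemma SL2Z_mx2 a b c d : a * d - b * c = 1 -> SL2Z (mx2 a b c d).
Proof. by move=> h; rewrite /SL2Z /= det_mx2. Qed.

Lemma SL2Z_det M : SL2Z M -> M 0 0 * M 1 1 - M 0 1 * M 1 0 = 1.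
Proof. by rewrite {1}[M]mx2_eta /SL2Z /= det_mx2. Qed.

Lemma SL2Z_detR M : SL2Z M ->
  (M 0 0)%:~R * (M 1 1)%:~R - (M 0 1)%:~R * (M 1 0)%:~R = 1 :> C.
Proof. by move=> /SL2Z_det h; rewrite -!intrM -intrB h. Qed.

Variables (n : nat) (chi : 'M[int]_2 -> C).
Hypothesis chiP : theta_character n chi.

Let chi_neq0 M : SL2Z M -> chi M != 0. Proof. by case: chiP => h _ _ _; exact: h. Qed.
Let chiM M N : SL2Z M -> SL2Z N -> chi (M *m N) = chi M * chi N.
Proof. by case: chiP => _ h _ _; exact: h. Qed.

Lemma theta_character1 : chi (mx2 1 0 0 1) = 1.
Proof.
have I1 : SL2Z (mx2 1 0 0 1) by apply: SL2Z_mx2.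
apply: (mulfI (chi_neq0 I1)); rewrite -chiM // mx2M.
by rewrite !(mulr0, mul0r, mulr1, addr0, add0r).
Qed.

Let SL2Z_S : SL2Z mxS. Proof. by apply: SL2Z_mx2. Qed.
Let SL2Z_R : SL2Z mxR. Proof. by apply: SL2Z_mx2. Qed.

Lemma theta_characterN1 : chi (mx2 (-1) 0 0 (-1)) = - (-1) ^+ n.
Proof.
have -> : mx2 (-1) 0 0 (-1) = mxS *m mxS.
  by rewrite mx2M !(mulr0, mul0r, mulr1, mul1r, addr0, add0r).
case: chiP => _ _ _ chiS; rewrite chiM // chiS -[in RHS]signr_odd.
case: (odd n); first by rewrite mulr1 expr1 opprK.
by rewrite -expr2 sqr_i expr0.
Qed.

Lemma theta_characterT : chi (mx2 1 4 0 1) = 1.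
Proof.
have -> : mx2 1 4 0 1 = mxR *m mxR *m (mxR *m mxR).
  by rewrite !mx2M !(mulr0, mul0r, mulr1, mul1r, addr0, add0r).
have RR : SL2Z (mxR *m mxR) by rewrite mx2M; apply: SL2Z_mx2.
case: chiP => _ _ chiRS chiS; rewrite !chiM // in chiRS *.
have S4 : chi mxS ^+ 4 = 1.
  rewrite chiS; case: (odd n); first by rewrite expr1n.
  by rewrite (exprM _ 2 2) sqr_i sqrrN expr1n.
rewrite -!expr2 -exprM -[LHS]mulr1 -S4 -exprMn chiRS.
by rewrite expr1n.
Qed.

Lemma theta_character_multiplier M : SL2Z M ->
  multiplier_spec n (M 0 0)%:~R (M 0 1)%:~R (M 1 0)%:~R (M 1 1)%:~R (chi M).
Proof.
move=> slM; have det := SL2Z_det slM.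
have sq : chi M ^+ 2 = chi (M *m M) by rewrite chiM.
split; [exact: SL2Z_detR | exact: chi_neq0 | |].
  move=> /eqP; rewrite intr_eq0 => /eqP b0 /eqP; rewrite intr_eq0 => /eqP c0 /intr_inj ad.
  rewrite b0 mul0r subr0 ad in det.
  rewrite expr_div_n sq [M]mx2_eta b0 c0 ad mx2M !(mulr0, mul0r, addr0, add0r) det.
  by rewrite theta_character1 mx2E -exprM mulnC exprM expr2 -intrM det expr1n divr1.
rewrite -intrD => /eqP; rewrite intr_eq0 addr_eq0 => /eqP aNd.
have MM : M *m M = mx2 (-1) 0 0 (-1).
  rewrite [M]mx2_eta mx2M aNd; rewrite aNd in det.
  have e : M 0 1 * M 1 0 = -1 - M 1 1 * M 1 1 by rewrite -[X in - X - _]det; ring.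
  rewrite [M 1 0 * M 0 1]mulrC e; congr mx2; ring.
by rewrite sq MM theta_characterN1 mulNr -expr2 sqrr_sign.
Qed.
End Characters.

(** * Conjugate groups have the same weight *)

Section ThetaConjugacy.
Variable R : realType.
Local Notation C := R[i].
Local Notation P2 := (P2 R).

Definition theta_x (M : 'M[int]_2) (x : C) : C :=
  mobius (M 0 0)%:~R (M 0 1)%:~R (M 1 0)%:~R (M 1 1)%:~R x.
Definition theta_y n (chi : 'M[int]_2 -> C) (M : 'M[int]_2) (x y : C) : C :=
  chi M * y / ((M 1 0)%:~R * x + (M 1 1)%:~R) ^+ n.

Lemma theta_affine_pt n chi M x y :
  theta n chi M (affine_pt x y) = affine_pt (theta_x M x) (theta_y n chi M x y) :> P2.
Proof. by rewrite /theta /= !affine_ptK. Qed.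

Lemma theta_pull n chi M (A : C -> C -> Prop) : SL2Z M -> chi M != 0 ->
  generically A -> generically (fun x y => A (theta_x M x) (theta_y n chi M x y)).
Proof.
move=> slM chi0; apply: generic_mobius_pull => //.
by rewrite SL2Z_detR // oner_neq0.
Qed.

Definition intertwines m n (chim chin : 'M[int]_2 -> C) (P Q : C -> C -> C) M M' :=
  generically (fun x y =>
    P (theta_x M x) (theta_y m chim M x y) = theta_x M' (P x y) /\
    Q (theta_x M x) (theta_y m chim M x y) = theta_y n chin M' (P x y) (Q x y)).

Lemma intertwining_weight_divides m n (chim chin : 'M[int]_2 -> C) (P Q T : C -> C -> C) :
  theta_character m chim -> theta_character n chin ->
  ratfun P -> ratfun Q ->
  (forall A, generically A -> generically (fun x y => A (P x y) (Q x y))) ->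
  generically (fun x y => T (P x y) (Q x y) = x) ->
  (forall M, SL2Z M -> exists2 M', SL2Z M' & intertwines m n chim chin P Q M M') ->
  (m %| n)%N.
Proof.
move=> chimP chinP rP rQ PQ TE HM.
have semi M : SL2Z M -> semiconjugates m n P Q (M 0 0)%:~R (M 0 1)%:~R
    (M 1 0)%:~R (M 1 1)%:~R (chim M).
  move=> slM; have [M' slM' gM] := HM M slM.
  do 5! eexists; split; first exact: (theta_character_multiplier chinP slM').
  have M'0 : (((M' 1 0)%:~R : C) != 0) || (((M' 1 1)%:~R : C) != 0).
    apply: (@mobius_det_neq0 _ (M' 0 0)%:~R (M' 0 1)%:~R).
    by rewrite SL2Z_detR // oner_neq0.
  have := generic_and (P_avoids_linear PQ M'0) gM.
  by apply: genericW => x y [? [? ?]]; split.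
have S0 : chim mxS != 0 by case: chimP => h _ _ _; apply/h/SL2Z_mx2.
apply: (weight_divides rP rQ PQ S0 TE).
- have := semi (mx2 1 4 0 1) (SL2Z_mx2 _).
  by rewrite !mx2E (theta_characterT chimP); apply.
- have := semi (mx2 (-1) 0 0 (-1)) (SL2Z_mx2 _).
  by rewrite !mx2E (theta_characterN1 chimP); apply.
- have := semi mxS (SL2Z_mx2 _).
  by rewrite !mx2E; apply.
Qed.

(** Composing f o theta_m(M) o g = theta_n(M') with f on the right shows that f
    intertwines the actions; composing it with g on the left shows that g does. *)
Lemma conjugate_weights m n (chim chin : 'M[int]_2 -> C) :
  theta_character m chim -> theta_character n chin ->
  birationally_conjugate (theta_SL2Z m chim) (theta_SL2Z n chin) -> m = n.
Proof.
move=> chimP chinP [f [g [[rf rg gfK fgK] [conj1 conj2]]]].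
have [rfx rfy] := dominant_ratfun rf fgK.
have [rgx rgy] := dominant_ratfun rg gfK.
have domf := dominant_generic rf fgK.
have domg := dominant_generic rg gfK.
have pullf A : generically A -> generically (fun x y => A (xpart f x y) (ypart f x y)).
  by move/domf; apply: genericW => x y [].
have pullg A : generically A -> generically (fun x y => A (xpart g x y) (ypart g x y)).
  by move/domg; apply: genericW => x y [].
have gT : generically (fun x y : C => True) by exists 1; rewrite ?oner_neq0.
have gf : generically (fun x y => xpart g (xpart f x y) (ypart f x y) = x /\
    ypart g (xpart f x y) (ypart f x y) = y).
  have := generic_and (domf _ gT) (rat_eq_generic gfK).
  apply: genericW => x y [[fE _] /=]; rewrite fE => gE.
  by rewrite {1}/xpart /ypart gE !affine_ptK.
have fg : generically (fun x y => xpart f (xpart g x y) (ypart g x y) = x /\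
    ypart f (xpart g x y) (ypart g x y) = y).
  have := generic_and (domg _ gT) (rat_eq_generic fgK).
  apply: genericW => x y [[fE _] /=]; rewrite fE => gE.
  by rewrite {1}/xpart /ypart gE !affine_ptK.
have read M M' : rat_eq (pcomp f (pcomp (theta m chim M) g)) (theta n chin M') ->
  generically (fun x y =>
    xpart f (theta_x M (xpart g x y)) (theta_y m chim M (xpart g x y) (ypart g x y))
      = theta_x M' x /\
    ypart f (theta_x M (xpart g x y)) (theta_y m chim M (xpart g x y) (ypart g x y))
      = theta_y n chin M' x y).
  move=> /rat_eq_generic /(generic_and (domg _ gT)); apply: genericW => x y [[gE _]].
  rewrite -[pcomp _ _ _]/(f (theta m chim M (g (affine_pt x y)))).
  rewrite gE !theta_affine_pt => fE.
  by rewrite [xpart f (theta_x _ _)]/xpart [ypart f (theta_x _ _)]/ypart fE !affine_ptK.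
have mn : (m %| n)%N.
  apply: (intertwining_weight_divides (T := xpart g) chimP chinP rfx rfy pullf).
    by apply: genericW gf => x y [].
  move=> M slM; have [|_ [M' slM' <-] /read /pullf gM] := conj1 (theta m chim M).
    by exists M.
  exists M' => //; apply: genericW (generic_and gf gM) => x y [[e1 e2]].
  by rewrite e1 e2.
have nm : (n %| m)%N.
  apply: (intertwining_weight_divides (T := xpart f) chinP chimP rgx rgy pullg).
    by apply: genericW fg => x y [].
  move=> M slM; have [|_ [M' slM' <-] /read gM] := conj2 (theta n chin M).
    by exists M.
  have chi0 : chim M' != 0 by case: chimP => h _ _ _; exact: h.
  exists M' => //.
  have := generic_and gM (pullg _ (theta_pull m slM' chi0 gf)).
  by apply: genericW => x y [[-> ->]].
by apply/eqP; rewrite eqn_dvd mn nm.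
Qed.

Lemma zopen_setT_P2 : zopen (setT : set P2).
Proof.
exists [set 'X_j | j in setT]; apply/seteqP; split=> v /=.
  move=> [a _ <-]; have /eqP/rowP := valP a.
  move=> a0; have [j aj] : exists j, val a 0 j != 0.
    apply: contrapT => /forallNP h; apply: a0 => j; rewrite mxE.
    by apply/eqP/negPn/negP; exact: h.
  by exists 'X_j; [exists j|rewrite pevalX].
move=> [_ [j _ <-]]; rewrite pevalX => vj.
have vc : P2_cone v by apply: contraNneq vj => ->; rewrite mxE.
by exists (exist (fun v => P2_cone v) v vc).
Qed.

Lemma birationally_conjugate_refl n (chi : 'M[int]_2 -> C) :
  birationally_conjugate (theta_SL2Z n chi) (theta_SL2Z n chi).
Proof.
have pid_rational : is_rational (pid P2).
  split; [exact: zopen_setT_P2 | by exists (affine_pt 0 0); exact: I |].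
  move=> V oV.
  have -> : pdom (pid P2) `&` pid P2 @^-1` V = V by rewrite setTI.
  by split=> [|h]; [exact: oV | exact: id].
have pidK : rat_eq (pcomp (pid P2) (pid P2)) (pid P2).
  exists setT; split=> //; [exact: zopen_setT_P2 | by exists (affine_pt 0 0); exact: I].
have conj a : theta_SL2Z n chi a -> rat_eq (pcomp (pid P2) (pcomp a (pid P2))) a.
  move=> [M slM <-].
  have domE : pdom (theta n chi M) =
      affine_open ((M 1 0)%:~R%:P%:P * 'X + (M 1 1)%:~R%:P%:P) :> set P2.
    apply/seteqP; split=> p [x [y [-> h]]]; exists x, y; split=> //.
      by rewrite !(hornerD, hornerM, hornerC, hornerX).
    by move: h; rewrite !(hornerD, hornerM, hornerC, hornerX).
  exists (pdom (theta n chi M)); split=> //.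
  - by rewrite domE; exact: zopen_affine_open.
  - have det0 : (M 0 0)%:~R * (M 1 1)%:~R - (M 0 1)%:~R * (M 1 0)%:~R != 0 :> C.
      by rewrite SL2Z_detR // oner_neq0.
    have [x hx] := cofinitely_ex (cofinitely_poly (linear_neq0 (mobius_det_neq0 det0))).
    exists (affine_pt x 0), x, 0; split=> //.
    by move: hx; rewrite !hornerE.
exists (pid P2), (pid P2); split; first by split.
by split=> a Ga; exists a => //; exact: conj.
Qed.

End ThetaConjugacy.

(** * Automorphisms of Hirzebruch surfaces *)

Section PolynomialLifts.
Variable R : realType.
Local Notation C := R[i].

Definition polynomial_map N M (F : 'rV[C]_N -> 'rV[C]_M) : Prop :=
  forall j, peval_algebra (fun v => F v 0 j).

Lemma polynomial_map_peval N M (F : 'rV[C]_N -> 'rV[C]_M) (e : {mpoly C[M]}) :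
  polynomial_map F -> exists e' : {mpoly C[N]}, forall v, peval e' v = peval e (F v).
Proof.
move=> pF; have [e' eE] := function_algebra_peval e (@peval_algebraP R N) pF.
by exists e' => v; rewrite -eE.
Qed.

Lemma vzopen_preimage N M (F : 'rV[C]_N -> 'rV[C]_M) (V : set 'rV[C]_M) :
  polynomial_map F -> vzopen V -> vzopen (F @^-1` V).
Proof.
move=> pF [S ->]; exists [set e' | exists2 e, S e & forall v, peval e' v = peval e (F v)].
apply/seteqP; split=> v /=.
  move=> [e Se eF]; have [e' e'E] := polynomial_map_peval e pF.
  by exists e'; [exists e | rewrite e'E].
by move=> [e' [e Se ->]]; exists e.
Qed.

Lemma vzopenI N (U V : set 'rV[C]_N) : vzopen U -> vzopen V -> vzopen (U `&` V).
Proof.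
move=> [S ->] [T ->]; exists [set e | exists s t, [/\ S s, T t & e = s * t]].
apply/seteqP; split=> v /=.
  move=> [[s Ss sv] [t Tt tv]]; exists (s * t); first by exists s, t.
  by rewrite pevalM mulf_neq0.
move=> [_ [s [t [Ss Tt ->]]]]; rewrite pevalM mulf_eq0 negb_or => /andP[sv tv].
by split; [exists s | exists t].
Qed.

Lemma vregular_comp N M (F : 'rV[C]_N -> 'rV[C]_M) (U : set 'rV[C]_M)
    (W : set 'rV[C]_N) f :
  polynomial_map F -> vzopen W -> W `<=` F @^-1` U ->
  vregular U f -> vregular W (f \o F).
Proof.
move=> pF oW WU fr v Wv; have [V [p [q [oV Vv VU fE]]]] := fr _ (WU v Wv).
have [p' pE] := polynomial_map_peval p pF.
have [q' qE] := polynomial_map_peval q pF.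
exists (W `&` F @^-1` V), p', q'; split=> //.
- by apply: vzopenI => //; exact: vzopen_preimage.
- by move=> w [_ Vw]; rewrite pE qE; exact: fE.
Qed.

(** The lift pulls polynomials back to polynomials, hence open cones to open cones
    and local fractions to local fractions. *)
Lemma regular_map_lift N M (A : pred 'rV[C]_N) (B : pred 'rV[C]_M)
    (e : equiv_rel {v | A v}) (e' : equiv_rel {v | B v})
    (D : set (quotient_variety e)) (f : quotient_variety e -> quotient_variety e')
    (F : 'rV[C]_N -> 'rV[C]_M) :
  polynomial_map F -> zopen D ->
  (forall a, D (\pi_{eq_quot e} a) -> exists b : {v | B v},
     val b = F (val a) /\ f (\pi_{eq_quot e} a) = \pi_{eq_quot e'} b) ->
  regular_map_on D f.
Proof.
move=> pF oD lift V oV.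
have preimE : preim_pi (D `&` f @^-1` V) = preim_pi D `&` F @^-1` preim_pi V.
  apply/seteqP; split=> v.
    move=> [a [Da Va] <-]; split; first by exists a.
    have [b [bE fE]] := lift a Da; exists b => //.
    by move: Va; rewrite /= fE.
  move=> [[a Da <-] [b' Vb' b'E]]; exists a => //; split=> //=.
  have [b [bE fE]] := lift a Da.
  by rewrite fE (_ : b = b') //; apply: val_inj; rewrite bE b'E.
have oDV : vzopen (preim_pi (D `&` f @^-1` V)).
  by rewrite preimE; apply: vzopenI => //; exact: vzopen_preimage.
split=> // g [g' g'r g'E]; exists (g' \o F).
  by apply: vregular_comp g'r => //; rewrite preimE => v [].
move=> a [Da Va]; have [b [bE fE]] := lift a Da.
by rewrite /= fE -bE; apply: g'E; rewrite -fE.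
Qed.

End PolynomialLifts.

Section HirzebruchSurface.
Variables (R : realType) (n : nat).
Local Notation C := R[i].
Local Notation Fn := (Hirzebruch R n).
Local Notation P2 := (P2 R).
Local Notation eqFn := (EquivRelPack (@Hirz_rel_equiv R n)).
Local Notation cone := {v : 'rV[C]_4 | Hirz_cone v}.

Definition row4 (a b c d : C) : 'rV[C]_4 := \row_j [:: a; b; c; d]`_j.

Lemma row4E a b c d : (row4 a b c d 0 0 = a) * (row4 a b c d 0 1 = b) *
  (row4 a b c d 0 2%:R = c) * (row4 a b c d 0 3%:R = d).
Proof. by rewrite !mxE. Qed.

Lemma ord4 (j : 'I_4) : [\/ j = 0, j = 1, j = 2%:R | j = 3%:R].
Proof.
case: j => [[|[|[|[|//]]]] jP];
  [apply: Or41|apply: Or42|apply: Or43|apply: Or44]; exact: val_inj.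
Qed.

Lemma row4_eta (v : 'rV[C]_4) : v = row4 (v 0 0) (v 0 1) (v 0 2%:R) (v 0 3%:R).
Proof.
by apply/rowP => j; have [->|->|->|->] := ord4 j; rewrite row4E.
Qed.

Lemma Hirz_act_row4 mu rho a b c d : Hirz_act n mu rho (row4 a b c d) =
  row4 (mu * rho ^- n * a) (mu * b) (rho * c) (rho * d).
Proof. by rewrite [LHS]row4_eta !mxE. Qed.

Lemma polynomial_row4 N (f0 f1 f2 f3 : 'rV[C]_N -> C) :
  peval_algebra f0 -> peval_algebra f1 -> peval_algebra f2 -> peval_algebra f3 ->
  polynomial_map (fun v => row4 (f0 v) (f1 v) (f2 v) (f3 v)).
Proof.
move=> [p0 h0] [p1 h1] [p2 h2] [p3 h3] j.
have [->|->|->|->] := ord4 j; [exists p0|exists p1|exists p2|exists p3] => v;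
  by rewrite row4E.
Qed.

Definition hirz_vec (x y : C) : 'rV[C]_4 := row4 1 y x 1.

Lemma hirz_vec_cone x y : Hirz_cone (hirz_vec x y).
Proof. by rewrite /Hirz_cone /= !row4E oner_neq0 orbT. Qed.

Definition hirz_pt (x y : C) : Fn :=
  \pi_{eq_quot eqFn} (exist (fun v => Hirz_cone v) _ (hirz_vec_cone x y)).

Lemma pi_hirz (a : cone) x y mu rho : mu != 0 -> rho != 0 ->
  val a = row4 (mu * rho ^- n) (mu * y) (rho * x) rho ->
  \pi_{eq_quot eqFn} a = hirz_pt x y.
Proof.
move=> mu0 rho0 aE; apply/esym/eqmodP/asboolP; exists mu, rho; split=> //.
by rewrite aE /= Hirz_act_row4 !mulr1.
Qed.

Lemma pi_hirz_pt (a : cone) x y : \pi_{eq_quot eqFn} a = hirz_pt x y ->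
  exists mu rho, [/\ mu != 0, rho != 0 &
    val a = row4 (mu * rho ^- n) (mu * y) (rho * x) rho].
Proof.
move=> /esym/eqmodP/asboolP[mu [rho [mu0 rho0 E]]]; exists mu, rho; split=> //.
by rewrite E /= Hirz_act_row4 !mulr1.
Qed.

Definition hirz_coordx (w : 'rV[C]_4) : C := w 0 2%:R / w 0 3%:R.
Definition hirz_coordy (w : 'rV[C]_4) : C := w 0 1 / (w 0 0 * w 0 3%:R ^+ n).

Lemma hirz_chart (a : cone) : val a 0 0 != 0 -> val a 0 3%:R != 0 ->
  \pi_{eq_quot eqFn} a = hirz_pt (hirz_coordx (val a)) (hirz_coordy (val a)).
Proof.
move=> a0 a3; have a3n := expf_neq0 n a3.
apply: (@pi_hirz _ _ _ (val a 0 0 * val a 0 3%:R ^+ n) (val a 0 3%:R)) => //.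
  exact: mulf_neq0.
rewrite [LHS]row4_eta /hirz_coordx /hirz_coordy.
congr row4; first by rewrite mulfK.
  by rewrite mulrC divfK // mulf_neq0.
by rewrite mulrC divfK.
Qed.

Lemma hirz_ptK (a : cone) x y : \pi_{eq_quot eqFn} a = hirz_pt x y ->
  [/\ val a 0 0 != 0, val a 0 3%:R != 0, hirz_coordx (val a) = x &
      hirz_coordy (val a) = y].
Proof.
move=> /pi_hirz_pt[mu [rho [mu0 rho0 ->]]]; rewrite /hirz_coordx /hirz_coordy !row4E.
have r0 := expf_neq0 n rho0; split=> //; first by rewrite mulf_neq0 // invr_neq0.
  by rewrite mulrC mulKf.
by rewrite divfK // mulrC mulKf.
Qed.

Definition hirz_open (c d : C) : set Fn :=
  [set q | exists x y, q = hirz_pt x y /\ c * x + d != 0].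

Lemma zopen_hirz_open c d : zopen (hirz_open c d).
Proof.
exists [set 'X_0 * 'X_3%:R * (c%:MP_[4] * 'X_2%:R + d%:MP_[4] * 'X_3%:R)].
apply/seteqP; split=> w /=.
  move=> [a [x [y [E jx]]] <-]; eexists; first by [].
  have [a0 a3 xE _] := hirz_ptK E.
  rewrite !(pevalM, pevalD, pevalC, pevalX) !mulf_neq0 //.
  move: jx; rewrite -xE /hirz_coordx => jx.
  rewrite (_ : _ + _ = (c * (val a 0 2%:R / val a 0 3%:R) + d) * val a 0 3%:R).
    by rewrite mulf_neq0.
  by rewrite mulrDl -mulrA divfK.
move=> [_ ->]; rewrite !(pevalM, pevalD, pevalC, pevalX) !mulf_eq0 !negb_or.
move=> /andP[/andP[w0 w3] jw].
have wc : Hirz_cone w by rewrite /Hirz_cone /= w0 w3 orbT.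
exists (exist (fun v => Hirz_cone v) w wc) => //.
eexists; eexists; split; first exact: hirz_chart.
rewrite /hirz_coordx /=; apply: contraNneq jw => j0.
rewrite (_ : _ + _ = (c * (w 0 2%:R / w 0 3%:R) + d) * w 0 3%:R); last first.
  by rewrite mulrDl -mulrA divfK.
by rewrite j0 mul0r.
Qed.

Lemma zopen_setT_hirz : zopen (setT : set Fn).
Proof.
exists [set e | exists i j, [/\ (i == 0) || (i == 1), (j == 2%:R) || (j == 3%:R) &
  e = 'X_i * 'X_j :> {mpoly C[4]}]].
apply/seteqP; split=> w /=.
  move=> [a _ <-]; have /andP[/orP h1 /orP h2] := valP a.
  have [i [iP vi]] : exists i, ((i == 0) || (i == 1)) /\ val a 0 i != 0.
    by case: h1 => h; [exists 0 | exists 1].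
  have [j [jP vj]] : exists j, ((j == 2%:R) || (j == 3%:R)) /\ val a 0 j != 0.
    by case: h2 => h; [exists 2%:R | exists 3%:R].
  exists ('X_i * 'X_j); first by exists i, j.
  by rewrite pevalM !pevalX mulf_neq0.
move=> [_ [i [j [iP jP ->]]]]; rewrite pevalM !pevalX mulf_eq0 negb_or => /andP[wi wj].
suff wc : Hirz_cone w by exists (exist (fun v => Hirz_cone v) w wc).
apply/andP; split; apply/orP.
  by case/orP: iP wi => /eqP ->; [left|right].
by case/orP: jP wj => /eqP ->; [left|right].
Qed.

(** On the chart y_0 z_1 <> 0 of F_n the invariant coordinates are z_0 / z_1 and
    y_1 / (y_0 z_1^n). The second one has degree - n in (z_0, z_1), which matches
    the factor (c x + d)^-n of theta_n. *)
Definition to_hirz : pmap P2 Fn :=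
  PMap (affine_open 1) (fun p => hirz_pt (xcoord p) (ycoord p)).

Definition from_hirz : pmap Fn P2 :=
  PMap (hirz_open 0 1) (fun q : Fn =>
    let w := val (repr (q : {eq_quot eqFn})) in
    affine_pt (hirz_coordx w) (hirz_coordy w)).

Lemma to_hirzE x y : to_hirz (affine_pt x y) = hirz_pt x y.
Proof. by rewrite /= !affine_ptK. Qed.

Lemma from_hirzE x y : from_hirz (hirz_pt x y) = affine_pt x y.
Proof.
rewrite /from_hirz /=; set a := repr _.
have aE : \pi_{eq_quot eqFn} a = hirz_pt x y by rewrite reprK.
by have [_ _ -> ->] := hirz_ptK aE.
Qed.

Lemma peval_algebra_exp N (f : 'rV[C]_N -> C) k :
  peval_algebra f -> peval_algebra (fun v => f v ^+ k).
Proof.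
move=> [e eE]; exists (e ^+ k) => v; rewrite eE.
by rewrite /peval rmorphXn.
Qed.

Lemma affine_open1 x y : affine_open 1 (affine_pt x y : P2).
Proof. by exists x, y; rewrite !hornerC oner_neq0. Qed.

Lemma hirz_open01 x y : hirz_open 0 1 (hirz_pt x y).
Proof. by exists x, y; rewrite mul0r add0r oner_neq0. Qed.

Lemma to_hirz_rational : is_rational to_hirz.
Proof.
have [_ algD algM] := @peval_algebraP R 3.
split; [exact: zopen_affine_open | by exists (affine_pt 0 0); exact: affine_open1 |].
apply: (@regular_map_lift _ _ _ _ _ _ _ _ _
  (fun v => row4 (v 0 2%:R) (v 0 1 * v 0 2%:R ^+ n) (v 0 0) (v 0 2%:R))).
- apply: polynomial_row4; try exact: peval_algebra_coord.
  have aX := @peval_algebra_coord R 3.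
  exact: (algM _ _ (aX 1) (peval_algebra_exp n (aX 2%:R))).
- exact: zopen_affine_open.
- move=> a [x [y [E _]]]; have [l l0 aE] := pi_affine_pt E.
  have bc : Hirz_cone (row4 l (l * y * l ^+ n) (l * x) l).
    by rewrite /Hirz_cone /= !row4E l0 orbT.
  exists (exist (fun v => Hirz_cone v) _ bc); split.
    by rewrite aE !mxE /= mulr1.
  rewrite E to_hirzE; apply/esym.
  apply: (@pi_hirz _ _ _ (l * l ^+ n) l) => //=; first by rewrite mulf_neq0 ?expf_neq0.
  by rewrite mulfK ?expf_neq0 // mulrAC.
Qed.

Lemma from_hirz_rational : is_rational from_hirz.
Proof.
have [_ algD algM] := @peval_algebraP R 4.
split; [exact: zopen_hirz_open | by exists (hirz_pt 0 0); exact: hirz_open01 |].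
pose F (w : 'rV[C]_4) : 'rV[C]_3 := \row_j [:: w 0 2%:R * w 0 0 * w 0 3%:R ^+ n;
  w 0 1 * w 0 3%:R; w 0 0 * w 0 3%:R ^+ n * w 0 3%:R]`_j.
apply: (@regular_map_lift _ _ _ _ _ _ _ _ _ F).
- have aX := @peval_algebra_coord R 4.
  have aXn := peval_algebra_exp n (aX 3%:R).
  case=> [[|[|[|//]]] jP].
  + have [e eE] := algM _ _ (algM _ _ (aX 2%:R) (aX 0)) aXn.
    by exists e => v; rewrite mxE /= eE.
  + by have [e eE] := algM _ _ (aX 1) (aX 3%:R); exists e => v; rewrite mxE /= eE.
  + have [e eE] := algM _ _ (algM _ _ (aX 0) aXn) (aX 3%:R).
    by exists e => v; rewrite mxE /= eE.
- exact: zopen_hirz_open.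
- move=> a [x [y [E _]]]; have [a0 a3 _ _] := hirz_ptK E.
  have a3n := expf_neq0 n a3.
  have F2 : F (val a) 0 2%:R != 0 by rewrite mxE /= !mulf_neq0.
  have bc : P2_cone (F (val a)) by apply: contraNneq F2 => ->; rewrite mxE.
  exists (exist (fun v => P2_cone v) _ bc); split=> //.
  rewrite (hirz_chart a0 a3) from_hirzE pi_P2 //= !mxE /= /hirz_coordx /hirz_coordy.
  by congr affine_pt; field; rewrite ?a0 ?a3 ?a3n.
Qed.

Lemma to_hirz_birational : birational_inverses to_hirz from_hirz.
Proof.
split; [exact: to_hirz_rational | exact: from_hirz_rational | |].
  exists (affine_open 1); split.
  - exact: zopen_affine_open.
  - by exists (affine_pt 0 0); exact: affine_open1.
  - move=> _ [x [y [-> _]]]; split=> //; split; first exact: affine_open1.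
    by rewrite /= !affine_ptK; exact: hirz_open01.
  - by move=> _ [x [y [-> _]]]; rewrite -[LHS]/(from_hirz (to_hirz _)) to_hirzE from_hirzE.
exists (hirz_open 0 1); split.
- exact: zopen_hirz_open.
- by exists (hirz_pt 0 0); exact: hirz_open01.
- move=> _ [x [y [-> _]]]; split=> //; split; first exact: hirz_open01.
  change (affine_open 1 (from_hirz (hirz_pt x y))).
  by rewrite from_hirzE; exact: affine_open1.
- by move=> _ [x [y [-> _]]]; rewrite -[LHS]/(to_hirz (from_hirz _)) from_hirzE to_hirzE.
Qed.

Variable chi : 'M[int]_2 -> C.
Hypothesis chiP : theta_character n chi.

Definition hirz_lin (M : 'M[int]_2) (w : 'rV[C]_4) : 'rV[C]_4 :=
  row4 (w 0 0) (chi M * w 0 1)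
    ((M 0 0)%:~R * w 0 2%:R + (M 0 1)%:~R * w 0 3%:R)
    ((M 1 0)%:~R * w 0 2%:R + (M 1 1)%:~R * w 0 3%:R).

(** The induced map on F_n is described by a relation, as the image of the cone
    under L is part of what has to be shown. *)
Definition lifts (h : Fn -> Fn) (L : 'rV[C]_4 -> 'rV[C]_4) : Prop :=
  forall a : cone, exists b : cone,
    val b = L (val a) /\ h (\pi_{eq_quot eqFn} a) = \pi_{eq_quot eqFn} b.

Lemma lifts_uniq h h' L : lifts h L -> lifts h' L -> h = h'.
Proof.
move=> hL hL'; apply/funext => q; rewrite -[q]reprK.
have [b [bE ->]] := hL (repr q); have [b' [b'E ->]] := hL' (repr q).
by congr (\pi_ _ _); apply: val_inj; rewrite bE b'E.
Qed.

Lemma lifts_id : lifts id id. Proof. by move=> a; exists a. Qed.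

Lemma lifts_comp h h' L L' : lifts h L -> lifts h' L' -> lifts (h \o h') (L \o L').
Proof.
move=> hL hL' a; have [b [bE hE]] := hL' a; have [c [cE hE']] := hL b.
by exists c; rewrite cE bE /= hE hE'.
Qed.

Lemma hirz_linM M N : SL2Z M -> SL2Z N ->
  hirz_lin M \o hirz_lin N = hirz_lin (M *m N).
Proof.
move=> slM slN; apply/funext => w; rewrite /hirz_lin /= !row4E.
have chiM : chi (M *m N) = chi M * chi N by case: chiP => _ h _ _; exact: h.
rewrite chiM [M]mx2_eta [N]mx2_eta mx2M !mx2E.
by congr row4; rewrite ?intrD ?intrM; ring.
Qed.

Lemma hirz_lin1 : hirz_lin (mx2 1 0 0 1) = id.
Proof.
apply/funext => w; rewrite /hirz_lin !mx2E (theta_character1 chiP) [RHS]row4_eta.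
by rewrite !mul1r !mul0r addr0 add0r.
Qed.

Definition mx2_inv (M : 'M[int]_2) : 'M[int]_2 :=
  mx2 (M 1 1) (- M 0 1) (- M 1 0) (M 0 0).

Lemma SL2Z_inv M : SL2Z M -> SL2Z (mx2_inv M).
Proof. by move=> /SL2Z_det h; apply: SL2Z_mx2; rewrite -h; ring. Qed.

Lemma mx2_mulVmx M : SL2Z M -> mx2_inv M *m M = mx2 1 0 0 1.
Proof.
by move=> /SL2Z_det h; rewrite {2}[M]mx2_eta mx2M -h; congr mx2; ring.
Qed.

Lemma mx2_mulmxV M : SL2Z M -> M *m mx2_inv M = mx2 1 0 0 1.
Proof.
by move=> /SL2Z_det h; rewrite {1}[M]mx2_eta mx2M -h; congr mx2; ring.
Qed.

Lemma hirz_lin_cone M w : SL2Z M -> Hirz_cone w -> Hirz_cone (hirz_lin M w).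
Proof.
move=> slM; apply: contraTT; rewrite /Hirz_cone /= !negb_and !negb_or !negbK.
have chi0 : chi M != 0 by case: chiP => h _ _ _; exact: h.
have K : hirz_lin (mx2_inv M) (hirz_lin M w) = w.
  rewrite -[LHS]/((hirz_lin _ \o hirz_lin _) w) hirz_linM //; last exact: SL2Z_inv.
  by rewrite mx2_mulVmx // hirz_lin1.
case/orP => /andP[/eqP h1 /eqP h2]; apply/orP; [left|right].
  move: h1 h2; rewrite !row4E => -> /eqP.
  by rewrite mulf_eq0 (negPf chi0) /= => ->; rewrite eqxx.
by move: K; rewrite {1}/hirz_lin h1 h2 !mulr0 !addr0 => <-; rewrite !row4E eqxx.
Qed.

Lemma hirz_lin_act M mu rho w :
  hirz_lin M (Hirz_act n mu rho w) = Hirz_act n mu rho (hirz_lin M w).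
Proof.
rewrite [w]row4_eta Hirz_act_row4 /hirz_lin Hirz_act_row4 !row4E.
by congr row4; ring.
Qed.

Lemma hirz_lin_lifts M : SL2Z M -> exists h, lifts h (hirz_lin M).
Proof.
move=> slM.
exists (fun q : Fn => let a := repr (q : {eq_quot eqFn}) in
  \pi_{eq_quot eqFn} (exist (fun v => Hirz_cone v) _ (hirz_lin_cone slM (valP a)))).
move=> a; exists (exist (fun v => Hirz_cone v) _ (hirz_lin_cone slM (valP a))).
split=> //=; set a' := repr _.
have /esym/eqmodP/asboolP [mu [rho [mu0 rho0 E]]] :
    \pi_{eq_quot eqFn} a' = \pi_{eq_quot eqFn} a.
  by rewrite reprK.
by apply/esym/eqmodP/asboolP; exists mu, rho; split=> //=; rewrite E hirz_lin_act.
Qed.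

Lemma lifts_regular h M : lifts h (hirz_lin M) -> regular_map_on setT h.
Proof.
have [algC algD algM] := @peval_algebraP R 4.
have aX := @peval_algebra_coord R 4.
move=> hL; apply: regular_map_lift (hirz_lin M) _ zopen_setT_hirz _.
  by apply: polynomial_row4; rewrite ?[peval_algebra _]aX //;
    try apply: algD; apply: algM; (exact: algC || exact: aX).
by move=> a _; exact: hL.
Qed.

Definition hirz_action : set (Fn -> Fn) :=
  [set h | exists2 M, SL2Z M & lifts h (hirz_lin M)].

Lemma lifts_inverse h M : SL2Z M -> lifts h (hirz_lin M) ->
  exists k, [/\ lifts k (hirz_lin (mx2_inv M)), cancel h k & cancel k h].
Proof.
move=> slM hL; have [k kL] := hirz_lin_lifts (SL2Z_inv slM).
have kh : k \o h = id.
  apply: lifts_uniq lifts_id; rewrite -hirz_lin1 -(mx2_mulVmx slM).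
  by rewrite -hirz_linM //; [exact: lifts_comp | exact: SL2Z_inv].
have hk : h \o k = id.
  apply: lifts_uniq lifts_id; rewrite -hirz_lin1 -(mx2_mulmxV slM).
  by rewrite -hirz_linM //; [exact: lifts_comp | exact: SL2Z_inv].
exists k; split=> // q.
  by have := congr1 (fun f => f q) kh.
by have := congr1 (fun f => f q) hk.
Qed.

Lemma hirz_action_subgroup : Aut_subgroup hirz_action.
Proof.
split.
- move=> h [M slM hL]; split; first exact: lifts_regular hL.
  have [k [kL hk kh]] := lifts_inverse slM hL.
  by exists k; split=> //; exact: lifts_regular kL.
- exists (mx2 1 0 0 1); first exact: SL2Z_mx2.
  by rewrite hirz_lin1; exact: lifts_id.
- move=> h k [M slM hL] [N slN kL]; exists (M *m N).
    by rewrite /SL2Z /= det_mulmx slM slN mulr1.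
  by rewrite -hirz_linM //; exact: lifts_comp.
- move=> h k [M slM hL] hk kh; have [k' [kL hk' kh']] := lifts_inverse slM hL.
  exists (mx2_inv M); first exact: SL2Z_inv.
  by rewrite (_ : k = k') //; apply/funext => q; rewrite -[in LHS](kh' q) hk.
Qed.

(** The vector (1, chi y, a x + b, c x + d) is the image of the point
    theta_n(M)(x, y) under the torus element with rho = c x + d and
    mu = rho^n. *)
Lemma lifts_theta h M : SL2Z M -> lifts h (hirz_lin M) ->
  rat_eq (pcomp to_hirz (pcomp (theta n chi M) from_hirz)) (ptotal h).
Proof.
move=> slM hL.
have det0 : (M 0 0)%:~R * (M 1 1)%:~R - (M 0 1)%:~R * (M 1 0)%:~R != 0 :> C.
  by rewrite SL2Z_detR // oner_neq0.
exists (hirz_open (M 1 0)%:~R (M 1 1)%:~R); split.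
- exact: zopen_hirz_open.
- have [x hx] := cofinitely_ex (cofinitely_poly (linear_neq0 (mobius_det_neq0 det0))).
  exists (hirz_pt x 0), x, 0; split=> //.
  by move: hx; rewrite !hornerE.
- move=> _ [x [y [-> jx]]]; split=> //; split.
    split; first exact: hirz_open01.
    change (pdom (theta n chi M) (from_hirz (hirz_pt x y))).
    by rewrite from_hirzE; exists x, y.
  change (affine_open 1 (theta n chi M (from_hirz (hirz_pt x y)))).
  by rewrite from_hirzE theta_affine_pt; exact: affine_open1.
- move=> _ [x [y [-> jx]]].
  rewrite -[LHS]/(to_hirz (theta n chi M (from_hirz (hirz_pt x y)))).
  rewrite from_hirzE theta_affine_pt to_hirzE.
  have [b [bE hE]] := hL (exist (fun v => Hirz_cone v) _ (hirz_vec_cone x y)).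
  rewrite /= -/(hirz_pt x y) in hE; rewrite [RHS]hE; apply/esym.
  have jn := expf_neq0 n jx.
  apply: (pi_hirz jn jx); rewrite bE /hirz_lin /= !row4E !mulr1.
  congr row4; first by rewrite mulfV.
    by rewrite /theta_y [RHS]mulrC divfK.
  by rewrite /theta_x /mobius [RHS]mulrC divfK.
Qed.

Lemma theta_conjugate_hirz : exists H : set (Fn -> Fn), Aut_subgroup H /\
  birationally_conjugate (theta_SL2Z n chi) [set ptotal h | h in H].
Proof.
exists hirz_action; split; first exact: hirz_action_subgroup.
exists to_hirz, from_hirz; split; first exact: to_hirz_birational.
split.
  move=> _ [M slM <-]; have [h hL] := hirz_lin_lifts slM.
  by exists (ptotal h); [exists h => //; exists M | exact: lifts_theta].
move=> _ [h [M slM hL] <-]; exists (theta n chi M); first by exists M.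
exact: lifts_theta.
Qed.

End HirzebruchSurface.

Theorem proposition3p7 (R : realType) (chi : nat -> 'M[int]_2 -> R[i])
    (chiP : forall n : nat, theta_character n (chi n)) :
  (forall n : nat,
     exists H : set (Hirzebruch R n -> Hirzebruch R n),
       Aut_subgroup H /\
       birationally_conjugate (theta_SL2Z n (chi n))
         [set ptotal h | h in H]) /\
  (forall m n : nat,
     birationally_conjugate (theta_SL2Z m (chi m)) (theta_SL2Z n (chi n)) <->
     m = n).
Proof.
split=> [n|m n]; first exact: theta_conjugate_hirz.
split=> [|->]; first exact: conjugate_weights.
exact: birationally_conjugate_refl.
Qed.
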